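(* Let $(S,P)$ be a pair of bounded operators on a Hilbert space $\mathcal H$. Then $(S,P)$ is a $\Gamma$-isometry if and only if $P$ is an isometry and there is a bounded operator $C$ on $\mathcal H$ which commutes with $P$ and $P^*$ and has numerical radius not greater than $1$, such that $S=C+C^*P$.
   Context: All Hilbert spaces are complex and separable. Let $b\Gamma=\{(z_1+z_2,z_1z_2):|z_1|=|z_2|=1\}\subset\mathbb C^2$. A $\Gamma$-unitary is a commuting pair of normal operators whose (Taylor) joint spectrum is contained in $b\Gamma$. A $\Gamma$-isometry is a commuting pair $(S,P)$ on $\mathcal H$ for which there are a Hilbert space $\mathcal N\supseteq\mathcal H$ and a $\Gamma$-unitary $(\tilde S,\tilde P)$ on $\mathcal N$ leaving $\mathcal H$ invariant with $S=\tilde S|_{\mathcal H}$, $P=\tilde P|_{\mathcal H}$. The numerical radius of an operator $T$ is $\omega(T)=\sup\{|\langle Tx,x\rangle|:\|x\|\le1\}$. *)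

(* Defs.v *)
From HB Require Import structures.
From mathcomp Require Import all_boot all_order all_algebra.
From mathcomp Require Import all_classical all_reals all_analysis.
From mathcomp Require Import complex.

Set Implicit Arguments.
Unset Strict Implicit.
Unset Printing Implicit Defensive.

Import Order.TTheory GRing.Theory Num.Theory.
Import numFieldNormedType.Exports.

Local Open Scope classical_set_scope.
Local Open Scope ring_scope.
Local Open Scope complex_scope.

(* The norm of a normed module over R[i] takes its values in R[i]; the inner
   product is linear in its first argument. *)
HB.mixin Record CompleteNormedModule_isHilbert (R : realType) H
    of CompleteNormedModule R[i] H := {
  hdot : {dot H for (@Num.conj R[i])} ;
  hdot_norm : forall x : H, `|x| ^+ 2 = hdot x x
}.

#[short(type="hilbertType")]
HB.structure Definition Hilbert (R : realType) :=
  { H of CompleteNormedModule_isHilbert R H & CompleteNormedModule R[i] H }.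

Definition separable_space (T : topologicalType) : Prop :=
  exists2 D : set T, countable D & dense D.

Section operators.
Variables (R : realType) (H : hilbertType R).
Implicit Types (S P T : H -> H).

Definition bounded_op T : Prop :=
  exists M : R, forall x, `|T x| <= M%:C * `|x|.

Definition isometric T : Prop := forall x, `|T x| = `|x|.

Definition commute_op S T : Prop := forall x, S (T x) = T (S x).

(* If T is linear and bounded, the set below is a singleton for every y, by
   Riesz's representation theorem. *)
Definition adj T (y : H) : H :=
  xget 0 [set z | forall x, hdot (T x) y = hdot x z].

Lemma adj_unique T T' : (forall x y, hdot (T x) y = hdot x (T' y)) ->
  adj T = T'.
Proof.
move=> TT'; apply/funext => y; rewrite /adj; case: xgetP => [z _ zP|/(_ (T' y))].
  apply/eqP; rewrite -subr_eq0 -normr_eq0 -sqrf_eq0 hdot_norm.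
  by rewrite linearBr /= -zP TT' subrr.
by case=> x; rewrite TT'.
Qed.

Definition normal_op T : Prop := commute_op T (adj T).

Definition numerical_radius T : R :=
  sup [set complex.Re `|hdot (T x) x| | x in [set x : H | `|x| <= 1]].

(* The Koszul complex 0 -> H -> H * H -> H -> 0 of a commuting pair (S, P). *)
Definition koszul0 S P (x : H) : H * H := (S x, P x).

Definition koszul1 S P (u : H * H) : H := S u.2 - P u.1.

Definition koszul_exact S P : Prop :=
  [/\ forall x, koszul0 S P x = 0 -> x = 0,
      range (koszul0 S P) = [set u | koszul1 S P u = 0]
    & range (koszul1 S P) = setT].

Definition taylor_spectrum S P : set (R[i] * R[i]) :=
  [set l | ~ koszul_exact (fun x => S x - l.1 *: x) (fun x => P x - l.2 *: x)].

End operators.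

Definition bGamma (R : realType) : set (R[i] * R[i]) :=
  [set w | exists z1 z2 : R[i],
     [/\ `|z1| = 1, `|z2| = 1 & w = (z1 + z2, z1 * z2)]].

Definition Gamma_unitary (R : realType) (N : hilbertType R)
    (S P : {linear N -> N}) : Prop :=
  [/\ bounded_op S /\ bounded_op P, commute_op S P,
      normal_op S /\ normal_op P & taylor_spectrum S P `<=` @bGamma R].

(* The inclusion of H in N is an inner product preserving linear map V; the
   intertwining relations contain the invariance of the range of V. *)
Definition Gamma_isometry (R : realType) (H : hilbertType R)
    (S P : {linear H -> H}) : Prop :=
  commute_op S P /\
  exists (N : hilbertType R) (V : {linear H -> N}) (S' P' : {linear N -> N}),
    [/\ separable_space N,
        forall x y, hdot (V x) (V y) = hdot x y,
        Gamma_unitary S' P',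
        forall x, S' (V x) = V (S x)
      & forall x, P' (V x) = V (P x)].

(* Main.v *)
From HB Require Import structures.
Require Import Defs.
From mathcomp Require Import all_boot all_order all_algebra.
From mathcomp Require Import all_classical all_reals all_analysis.
From mathcomp Require Import complex.
From mathcomp Require Import ring lra.

Set Implicit Arguments.
Unset Strict Implicit.
Unset Printing Implicit Defensive.

Import Order.TTheory GRing.Theory Num.Theory.
Import numFieldNormedType.Exports.

Local Open Scope classical_set_scope.
Local Open Scope ring_scope.
Local Open Scope complex_scope.

(** Every point (s, p) of bGamma satisfies |p| = 1, s = s^* p and |s| <= 2, and the
    proof rests on the corresponding operator relations: P is isometric, S = S^* P and
    |S| <= 2.

    Let (S, P) be a Gamma-isometry. The three relations hold for its Gamma-unitary
    extension and then for (S, P) itself, as they can be written with inner products.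
    To obtain them from the Koszul spectrum, suppose that one of them fails for a
    Gamma-unitary. The failure is witnessed by a vector that one of the normal operators
    T = P, P^-1, S - S^* P, S stretches too much; all of them commute with S and P.
    Along the powers of T this vector turns into an approximate eigenvector of T^* T
    (power_step), and polarization yields approximate eigenvalues of T itself
    (approx_null_eigenvalue). Repeating this with P and S gives approximate joint
    eigenvectors (joint_spectral_point). By a gliding hump the Koszul complex is not
    exact at the corresponding point, which therefore lies in bGamma and satisfies the
    scalar relations: a contradiction. Fuglede's theorem can be avoided because P is
    first shown to be unitary, and S commutes with its inverse.

    From the three relations, C is found by following the Wold decomposition of P. On
    the unitary part C is S / 2. On the shift part S is the Toeplitz operator with symbol
    A + A^* z, where A is the compression of S to ker P^*, and C acts as A along all
    powers of P. These two contributions are combined into partial sums whose forms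
    converge (symbol_exists). The bound |S| <= 2 forces the numerical radius of A to be
    at most 1 (numerical_range_wandering), and C inherits it since the pieces of the
    decomposition are orthogonal.

    Conversely, let C be given. The isometry P extends to the unitary shift U on the
    space of bounded sequences x in H such that P^* x (n+1) = x n. Operators that commute
    with P^* act on this space entry by entry; so C extends, keeping its numerical
    radius, and C + C^* U extends S. This operator is normal, since its adjoint is U^*
    times itself and U^* commutes with it. Off bGamma the pair is jointly bounded below,
    because one of the scalar relations fails there, and then the Koszul complex is
    exact (bounded_below_koszul_exact, Gamma_unitary_intro). *)

(** * Complex moduli and the distinguished boundary *)

Notation cmod := Normc.normc.

Section modulus.
Variable R : realType.
Implicit Types a b : R[i].

Lemma cmod_ge0 a : 0 <= cmod a.
Proof. by case: a => x y; rewrite /Normc.normc sqrtr_ge0. Qed.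

Lemma sqr_cmod a : cmod a ^+ 2 = complex.Re a ^+ 2 + complex.Im a ^+ 2.
Proof. by case: a => x y /=; rewrite sqr_sqrtr // addr_ge0 // sqr_ge0. Qed.

Lemma cmodR (x : R) : cmod x%:C = `|x|.
Proof. by rewrite /= expr0n addr0 sqrtr_sqr. Qed.

Lemma cmodJ a : cmod a^*%C = cmod a.
Proof. by case: a => x y /=; rewrite sqrrN. Qed.

Lemma conjcM a b : (a * b)^*%C = a^*%C * b^*%C. Proof. exact: rmorphM. Qed.

Lemma cmodi : cmod ('i%C : R[i]) = 1.
Proof. by rewrite /= expr0n add0r expr1n sqrtr1. Qed.

Lemma cmod0 : cmod (0 : R[i]) = 0. Proof. exact: Normc.normc0. Qed.

Lemma cmodD a b : cmod (a + b) <= cmod a + cmod b.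
Proof. exact: le_normcD. Qed.

Lemma cmodN a : cmod (- a) = cmod a.
Proof. exact: normcN. Qed.

Lemma cmodB a b : cmod (a - b) <= cmod a + cmod b.
Proof. by rewrite -(cmodN b) cmodD. Qed.

Lemma cmod_gt0 a : a != 0 -> 0 < cmod a.
Proof.
by move=> a0; rewrite lt_def cmod_ge0 andbT; apply: contra_neq a0 => /Normc.eq0_normc.
Qed.

Lemma ler_Re_cmod a : `|complex.Re a| <= cmod a.
Proof.
rewrite -(@ler_pXn2r _ 2) ?nnegrE ?cmod_ge0 //.
by rewrite sqr_cmod real_normK ?num_real // lerDl sqr_ge0.
Qed.

Lemma normCE a : `|a| = (cmod a)%:C. Proof. by []. Qed.

Lemma mulCJ a : a * a^*%C = (cmod a ^+ 2)%:C.
Proof. by rewrite -sqr_normc rmorphXn. Qed.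

Lemma ReZ (t : R) a : complex.Re (t%:C * a) = t * complex.Re a.
Proof. by case: a => x y /=; rewrite mul0r subr0. Qed.

Lemma ReJ a : complex.Re a^*%C = complex.Re a. Proof. by case: a. Qed.
Lemma ReD a b : complex.Re (a + b) = complex.Re a + complex.Re b.
Proof. by case: a; case: b. Qed.
Lemma ReN a : complex.Re (- a) = - complex.Re a.
Proof. by case: a. Qed.
Lemma ImD a b : complex.Im (a + b) = complex.Im a + complex.Im b.
Proof. by case: a; case: b. Qed.
Lemma ReMi a : complex.Re (- 'i%C * a) = complex.Im a.
Proof. by case: a => x y /=; rewrite oppr0 mul0r sub0r mulN1r opprK. Qed.

(** Reduces the estimation of moduli to that of real parts. *)
Lemma rotate_to_real a : exists2 u : R[i], cmod u = 1 & u * a = (cmod a)%:C.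
Proof.
have [->|a0] := eqVneq a 0.
  by exists 1; rewrite ?Normc.normc1 // mulr0 Normc.normc0.
exists (a^*%C / (cmod a)%:C).
  rewrite Normc.normcM cmodJ Normc.normcV cmodR ger0_norm ?cmod_ge0 //.
  by rewrite divff // gt_eqF // cmod_gt0.
rewrite mulrAC [a^*%C * a]mulrC mulCJ expr2 rmorphM /= mulfK //.
by apply/eqP => -[] /eqP; rewrite gt_eqF // cmod_gt0.
Qed.

End modulus.

Section distinguished_boundary.
Variable R : realType.

Lemma bGammaP (w : R[i] * R[i]) : bGamma w ->
  [/\ cmod w.2 = 1, w.1 = w.1^*%C * w.2 & cmod w.1 <= 2].
Proof.
case=> z1 [z2 [n1 n2 ->]] /=.
have c1 : cmod z1 = 1 by apply: complexI; rewrite -normCE.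
have c2 : cmod z2 = 1 by apply: complexI; rewrite -normCE.
have z1J : z1 * z1^*%C = 1 by rewrite mulCJ c1 expr1n.
have z2J : z2 * z2^*%C = 1 by rewrite mulCJ c2 expr1n.
split; first by rewrite Normc.normcM c1 c2 mulr1.
  have -> : (z1 + z2)^*%C = z1^*%C + z2^*%C by rewrite rmorphD.
  transitivity (z2 * (z1 * z1^*%C) + z1 * (z2 * z2^*%C)); last by ring.
  by rewrite z1J z2J !mulr1 addrC.
by apply: le_trans (cmodD _ _) _; rewrite c1 c2.
Qed.

(** The roots of z^2 - l1 z + l2 are w u and w u^*, where w is a square root of
    l2 and u is the unimodular number of real part l1 w^* / 2. *)
Lemma bGamma_intro (l1 l2 : R[i]) :
  cmod l2 = 1 -> l1 = l1^*%C * l2 -> cmod l1 <= 2 -> bGamma (l1, l2).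
Proof.
move=> l2n l12 l1n; pose w := sqrtc l2.
have w2 : w * w = l2 by rewrite -expr2 sqr_sqrtc.
have wn : cmod w = 1.
  by apply/eqP; rewrite -(@eqrXn2 _ 2) ?cmod_ge0 // expr1n expr2 -Normc.normcM w2 l2n.
have wJ : w * w^*%C = 1 by rewrite mulCJ wn expr1n.
pose t := complex.Re (l1 * w^*%C).
have tE : l1 * w^*%C = t%:C.
  have h : (l1 * w^*%C)^*%C = l1 * w^*%C.
    rewrite conjcM conjcK [in RHS]l12 -w2.
    by rewrite -[RHS]mulrA -[w * w * _]mulrA wJ mulr1.
  by rewrite /t; apply: esym; apply: RRe_real; rewrite CrealE; apply/eqP.
have t2 : `|t| <= 2 by rewrite -cmodR -tE Normc.normcM cmodJ wn mulr1.
pose s := Num.sqrt (1 - (t / 2) ^+ 2).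
have ts : (t / 2) ^+ 2 + s ^+ 2 = 1.
  rewrite sqr_sqrtr; first by rewrite addrC subrK.
  rewrite subr_ge0 -real_normK ?num_real // expr_le1 // normrM [`|2^-1|]ger0_norm //.
  by rewrite ler_pdivrMr // mul1r.
pose u : R[i] := ((t / 2) +i* s)%C.
have un : cmod u = 1.
  by apply/eqP; rewrite -(@eqrXn2 _ 2) ?cmod_ge0 // expr1n sqr_cmod /= ts.
have uu : u + u^*%C = t%:C.
  by apply/eqP; rewrite eq_complex /= subrr eqxx andbT; apply/eqP; field.
exists (w * u), (w * u^*%C); split.
- by rewrite normCE Normc.normcM wn un mulr1.
- by rewrite normCE Normc.normcM cmodJ wn un mulr1.
congr (_, _).
  by rewrite -mulrDr uu -tE mulrCA wJ mulr1.
by rewrite mulrACA mulCJ un expr1n mulr1 w2.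
Qed.

End distinguished_boundary.

(** * The inner product and the norm *)

Section inner_product.
Variables (R : realType) (H : hilbertType R).
Implicit Types (x y z : H) (a b : R[i]).

Definition nrm x : R := complex.Re `|x|.
Definition rdot x y : R := complex.Re (hdot x y).

Lemma normE x : `|x| = (nrm x)%:C.
Proof. by rewrite /nrm RRe_real // normr_real. Qed.

Lemma nrm_ge0 x : 0 <= nrm x.
Proof. by rewrite -ler0c -normE. Qed.

Lemma dotC x y : hdot x y = (hdot y x)^*%C.
Proof. by rewrite hermC expr0 mul1r. Qed.
Lemma dotDl x y z : hdot (x + y) z = hdot x z + hdot y z.
Proof. exact: linearDl. Qed.
Lemma dotBl x y z : hdot (x - y) z = hdot x z - hdot y z.
Proof. exact: linearBl. Qed.
Lemma dotNl x y : hdot (- x) y = - hdot x y. Proof. exact: linearNl. Qed.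
Lemma dotZl a x y : hdot (a *: x) y = a * hdot x y.
Proof. exact: linearZl_LR. Qed.
Lemma dot0l y : hdot 0 y = 0. Proof. exact: linear0l. Qed.
Lemma dotDr x y z : hdot x (y + z) = hdot x y + hdot x z.
Proof. exact: linearDr. Qed.
Lemma dotBr x y z : hdot x (y - z) = hdot x y - hdot x z.
Proof. exact: linearBr. Qed.
Lemma dotNr x y : hdot x (- y) = - hdot x y. Proof. exact: linearNr. Qed.
Lemma dotZr a x y : hdot x (a *: y) = a^*%C * hdot x y.
Proof. exact: linearZr_LR. Qed.
Lemma dot0r x : hdot x 0 = 0. Proof. exact: linear0r. Qed.

Lemma dotxx x : hdot x x = (nrm x ^+ 2)%:C.
Proof. by rewrite -hdot_norm normE rmorphXn. Qed.

Lemma rdotxx x : rdot x x = nrm x ^+ 2.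
Proof. by rewrite /rdot dotxx. Qed.

Lemma rdotC x y : rdot x y = rdot y x.
Proof. by rewrite /rdot dotC ReJ. Qed.
Lemma rdotDl x y z : rdot (x + y) z = rdot x z + rdot y z.
Proof. by rewrite /rdot dotDl ReD. Qed.
Lemma rdotDr x y z : rdot x (y + z) = rdot x y + rdot x z.
Proof. by rewrite /rdot dotDr ReD. Qed.
Lemma rdotNl x y : rdot (- x) y = - rdot x y.
Proof. by rewrite /rdot dotNl ReN. Qed.
Lemma rdotNr x y : rdot x (- y) = - rdot x y.
Proof. by rewrite /rdot dotNr ReN. Qed.
Lemma rdotZl (t : R) x y : rdot (t%:C *: x) y = t * rdot x y.
Proof. by rewrite /rdot dotZl ReZ. Qed.
Lemma rdotZr (t : R) x y : rdot x (t%:C *: y) = t * rdot x y.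
Proof. by rewrite rdotC rdotZl rdotC. Qed.

Lemma Im_dot x y : complex.Im (hdot x y) = rdot x ('i%C *: y).
Proof.
rewrite /rdot dotZr -ReMi; congr (complex.Re (_ * _)).
by apply/eqP; rewrite eq_complex /= !oppr0 !eqxx.
Qed.

Lemma nrm0 : nrm 0 = 0. Proof. by rewrite /nrm normr0. Qed.
Lemma nrmN x : nrm (- x) = nrm x. Proof. by rewrite /nrm normrN. Qed.
Lemma nrm_eq0 x : nrm x = 0 -> x = 0.
Proof. by move=> x0; apply/eqP; rewrite -normr_eq0 normE x0. Qed.
Lemma nrm_gt0 x : x != 0 -> 0 < nrm x.
Proof.
by move=> x0; rewrite lt_def nrm_ge0 andbT; apply: contra_neq x0 => /nrm_eq0.
Qed.
Lemma nrmD x y : nrm (x + y) <= nrm x + nrm y.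
Proof. by rewrite -lecR rmorphD /= -!normE ler_normD. Qed.
Lemma nrmB x y : nrm (x - y) <= nrm x + nrm y.
Proof. by rewrite -(nrmN y) nrmD. Qed.
Lemma nrmBC x y : nrm (x - y) = nrm (y - x).
Proof. by rewrite -nrmN opprB. Qed.
Lemma nrmZ a x : nrm (a *: x) = cmod a * nrm x.
Proof. by apply: complexI; rewrite rmorphM /= -!normE normrZ normE. Qed.
Lemma nrmZR (t : R) x : nrm (t%:C *: x) = `|t| * nrm x.
Proof. by rewrite nrmZ cmodR. Qed.

Lemma sqr_nrmD x y : nrm (x + y) ^+ 2 = nrm x ^+ 2 + rdot x y *+ 2 + nrm y ^+ 2.
Proof.
rewrite -!rdotxx !rdotDl !rdotDr (rdotC y x); ring.
Qed.
Lemma sqr_nrmB x y : nrm (x - y) ^+ 2 = nrm x ^+ 2 - rdot x y *+ 2 + nrm y ^+ 2.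
Proof. by rewrite sqr_nrmD rdotNr nrmN mulNrn. Qed.

Lemma parallelogram x y :
  nrm (x + y) ^+ 2 + nrm (x - y) ^+ 2 = nrm x ^+ 2 *+ 2 + nrm y ^+ 2 *+ 2.
Proof. rewrite sqr_nrmB sqr_nrmD; ring. Qed.

Lemma rdot_polar x y : rdot x y = (nrm (x + y) ^+ 2 - nrm (x - y) ^+ 2) / 4.
Proof. by rewrite sqr_nrmB sqr_nrmD; field. Qed.

Lemma rdot_CS x y : `|rdot x y| <= nrm x * nrm y.
Proof.
have [->|y0] := eqVneq y 0.
  by rewrite /rdot dot0r normr0 mulr_ge0 // nrm_ge0.
have y_gt0 := nrm_gt0 y0.
rewrite -(@ler_pXn2r _ 2) ?nnegrE ?mulr_ge0 ?nrm_ge0 //.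
rewrite real_normK ?num_real //.
have := sqr_ge0 (nrm (x - (rdot x y / nrm y ^+ 2)%:C *: y)).
rewrite sqr_nrmB nrmZR rdotZr exprMn real_normK ?num_real //.
have -> : nrm x ^+ 2 - rdot x y / nrm y ^+ 2 * rdot x y *+ 2
   + (rdot x y / nrm y ^+ 2) ^+ 2 * nrm y ^+ 2 =
   nrm x ^+ 2 - rdot x y ^+ 2 / nrm y ^+ 2.
  by field; rewrite gt_eqF.
by rewrite subr_ge0 ler_pdivrMr ?exprn_gt0 // exprMn.
Qed.

Lemma dot_CS x y : cmod (hdot x y) <= nrm x * nrm y.
Proof.
have [u u1 ux] := rotate_to_real (hdot x y).
have : rdot (u *: x) y <= nrm (u *: x) * nrm y.
  by apply: le_trans (rdot_CS _ _); apply: ler_norm.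
by rewrite nrmZ u1 mul1r /rdot dotZl ux.
Qed.

Lemma dot_inj x y : (forall z, hdot z x = hdot z y) -> x = y.
Proof.
move=> xy; apply/eqP; rewrite -subr_eq0; apply/eqP/nrm_eq0/eqP.
by rewrite -sqrf_eq0 -rdotxx /rdot dotBr xy subrr.
Qed.

Lemma dot_injl x y : (forall z, hdot x z = hdot y z) -> x = y.
Proof. by move=> xy; apply: dot_inj => z; rewrite dotC xy -dotC. Qed.

Lemma rdot_inj x y : (forall z, rdot z x = rdot z y) -> x = y.
Proof.
move=> xy; apply/eqP; rewrite -subr_eq0; apply/eqP/nrm_eq0/eqP.
by rewrite -sqrf_eq0 -rdotxx rdotDr rdotNr xy subrr.
Qed.

Lemma nrm_le x (M : R) : 0 <= M -> (forall y, rdot x y <= M * nrm y) -> nrm x <= M.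
Proof.
move=> M0 /(_ x); rewrite rdotxx expr2.
have [->|x0] := eqVneq x 0; first by rewrite nrm0.
by rewrite ler_pM2r // nrm_gt0.
Qed.

Lemma isometric_dot (T : {linear H -> H}) : (forall x, nrm (T x) = nrm x) ->
  forall x y, hdot (T x) (T y) = hdot x y.
Proof.
move=> Tiso x y.
have Tr u v : rdot (T u) (T v) = rdot u v by rewrite !rdot_polar -linearD -linearB !Tiso.
apply/eqP; rewrite eq_complex; apply/andP; split; apply/eqP; first exact: Tr.
by rewrite !Im_dot -linearZ_LR /= Tr.
Qed.

End inner_product.

(** * Completeness, and the minimization of a coercive quadratic functional *)

Section completeness.
Variables (R : realType) (H : hilbertType R).
Implicit Types (x y z : H) (a b : R[i]).

Lemma exists_inv_lt (e : R) : 0 < e ->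
  exists N : nat, forall n : nat, (N <= n)%N -> n.+1%:R^-1 < e.
Proof.
move=> e0; exists (Num.truncn e^-1) => n Nn.
rewrite invf_plt ?posrE // (lt_le_trans (truncnS_gt _)) //.
by rewrite ler_nat ltnS.
Qed.

Lemma cauchy_nrm_converges (u : nat -> H) :
    (forall e : R, 0 < e -> exists N : nat, forall m n : nat,
      (N <= m)%N -> (N <= n)%N -> nrm (u m - u n) < e) ->
  exists l : H, forall e : R, 0 < e ->
    exists N : nat, forall n : nat, (N <= n)%N -> nrm (u n - l) < e.
Proof.
move=> u_cauchy.
have : cvgn u.
  apply/cauchy_cvgP/cauchy_exP => e e0.
  have eE : e = (complex.Re e)%:C by rewrite RRe_real // gtr0_real.
  have e0' : 0 < complex.Re e by rewrite -ltcR -eE.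
  have [N hN] := u_cauchy _ e0'.
  exists (u N); exists N => // n /= Nn.
  by rewrite -ball_normE /= normE eE ltcR hN.
move/cvg_ex => [l ul]; exists l => e e0.
have e0' : 0 < e%:C :> R[i] by rewrite ltcR.
have [N _ hN] := proj1 (cvgrPdist_lt _ l) ul _ e0'.
exists N => n Nn; rewrite nrmBC -ltcR -normE; exact: (hN n Nn).
Qed.

End completeness.

Section bounded.
Variables (R : realType) (H : hilbertType R).
Implicit Types (x y z : H) (a b : R[i]).

Lemma bounded_opP (T : H -> H) :
  bounded_op T <-> exists2 M : R, 0 <= M & forall x, nrm (T x) <= M * nrm x.
Proof.
split=> [[M hM]|[M M0 hM]].
  exists `|M| => // x; apply: (@le_trans _ _ (M * nrm x)).
    by rewrite -lecR rmorphM /= -!normE.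
  by rewrite ler_wpM2r ?nrm_ge0 // ler_norm.
by exists M => x; rewrite !normE -rmorphM lecR.
Qed.

(** The quadratic functional <Lx, x> - 2 f(x) is minimized along a Cauchy
    sequence by the parallelogram law, and its minimizer represents f. With L
    the identity this is Riesz's representation theorem. *)
Lemma real_lax_milgram (L : {linear H -> H}) (c M : R) (f : H -> R) :
    (forall x y, rdot (L x) y = rdot x (L y)) -> 0 < c ->
    (forall x, c * nrm x ^+ 2 <= rdot (L x) x) ->
    (forall x y, f (x + y) = f x + f y) ->
    (forall (t : R) x, f (t%:C *: x) = t * f x) ->
    (forall x, `|f x| <= M * nrm x) ->
  exists z, forall x, f x = rdot (L x) z.
Proof.
move=> Lsym c0 Lc fD fZ fM.
pose J x := rdot (L x) x - f x *+ 2.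
have JD x y t : J (x + t%:C *: y) =
    J x + t ^+ 2 * rdot (L y) y + (t * (rdot (L y) x - f y)) *+ 2.
  rewrite /J fD fZ linearD linearZ /= !(rdotDl, rdotDr, rdotZl, rdotZr).
  rewrite [rdot (L x) y]Lsym [rdot x (L y)]rdotC; ring.
have Jlb x : - (M ^+ 2 / c) <= J x.
  have := Lc x; have := fM x => /ler_normlP[_ fx] Lx.
  rewrite lerNl.
  have : 0 <= (c * nrm x - M) ^+ 2 / c by rewrite divr_ge0 ?sqr_ge0 // ltW.
  have -> : (c * nrm x - M) ^+ 2 / c = c * nrm x ^+ 2 - M * nrm x *+ 2 + M ^+ 2 / c.
    by field; rewrite gt_eqF.
  by rewrite /J; lra.
pose m := inf (range J).
have Jinf : has_inf (range J).
  by split; [exists (J 0), 0|exists (- (M ^+ 2 / c)) => _ [x _ <-]].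
have mJ x : m <= J x by apply: ge_inf; [exact: Jinf.2|exists x].
have /choice[u uP] (n : nat) : exists x, J x < m + n.+1%:R^-1.
  have n0 : 0 < n.+1%:R^-1 :> R by rewrite invr_gt0.
  by have [_ [x _ <-] ?] := inf_adherent n0 Jinf; exists x.
have udist i j : nrm (u i - u j) ^+ 2 <= (i.+1%:R^-1 + j.+1%:R^-1) * 2 / c.
  rewrite ler_pdivlMr // mulrC (le_trans (Lc _)) //.
  have -> : rdot (L (u i - u j)) (u i - u j) =
      (J (u i) + J (u j) - J (u i + (2^-1)%:C *: (u j - u i)) *+ 2) * 2.
    rewrite JD /J !linearB /= !(rdotDl, rdotDr, rdotNl, rdotNr).
    have -> : f (u j - u i) = f (u j) - f (u i).
      have -> : u j - u i = u j + (-1)%:C *: u i by rewrite rmorphN scaleN1r.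
      by rewrite fD fZ mulN1r.
    rewrite [rdot (L (u i)) (u j)]Lsym [rdot (u i) (L (u j))]rdotC; by field.
  have := uP i; have := uP j; have := mJ (u i + (2^-1)%:C *: (u j - u i)).
  move: (i.+1%:R^-1) (j.+1%:R^-1) => p q; lra.
have [|z uz] := @cauchy_nrm_converges R H u.
  move=> e e0.
  have e1 : 0 < e ^+ 2 * c / 4 by rewrite !mulr_gt0 // invr_gt0.
  have [N hN] := exists_inv_lt e1.
  exists N => i j Ni Nj.
  rewrite -(@ltr_pXn2r _ 2) ?nnegrE ?nrm_ge0 ?(ltW e0) //.
  apply: le_lt_trans (udist i j) _; rewrite ltr_pdivrMr //.
  have := hN _ Ni; have := hN _ Nj; move: (i.+1%:R^-1) (j.+1%:R^-1) => p q; lra.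
exists z => x.
have key (t : R) : 0 <= t ^+ 2 * rdot (L x) x + (t * (rdot (L x) z - f x)) *+ 2.
  apply/ler_addgt0Pl => e e0; rewrite addrC.
  pose d := e / 2 / (`|t| * nrm (L x) + 1) / 2.
  have d1 : 0 < `|t| * nrm (L x) + 1 by rewrite ltr_wpDl // mulr_ge0 // nrm_ge0.
  have d0 : 0 < d by rewrite !divr_gt0.
  have [N hN] := uz _ d0.
  have [N' hN'] := exists_inv_lt (divr_gt0 e0 (ltr0n R 2)).
  pose n := maxn N N'.
  have hn := hN n (leq_maxl _ _); have hn' := hN' n (leq_maxr _ _).
  have := mJ (u n + t%:C *: x); rewrite JD; have := uP n.
  have : t * (rdot (L x) (u n) - rdot (L x) z) <= e / 4.
    rewrite -rdotNr -rdotDr.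
    apply: le_trans (ler_norm _) _; rewrite normrM.
    apply: le_trans (ler_wpM2l _ (rdot_CS _ _)) _ => //.
    rewrite mulrA; apply: le_trans (ler_wpM2l _ (ltW hn)) _.
      by rewrite mulr_ge0 ?nrm_ge0.
    have : `|t| * nrm (L x) <= `|t| * nrm (L x) + 1 by rewrite lerDl.
    move=> /(ler_wpM2r (ltW d0))/le_trans; apply.
    suff -> : (`|t| * nrm (L x) + 1) * d = e / 4 by [].
    by rewrite /d; field; rewrite gt_eqF.
  move: hn'; move: (n.+1%:R^-1) => p; lra.
set s := rdot (L x) z - f x in key.
suff s0 : s = 0 by apply/eqP; rewrite eq_sym -subr_eq0 -/s s0.
set B := rdot (L x) x in key.
have B0 : 0 <= B by apply: le_trans (Lc x); rewrite mulr_ge0 ?sqr_ge0 ?ltW.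
have B1 : 0 < B + 1 by rewrite ltr_wpDl.
have := key (- s / (B + 1)).
have -> : (- s / (B + 1)) ^+ 2 * B + - s / (B + 1) * s *+ 2 =
    - (s ^+ 2 * ((B + 2) / (B + 1) ^+ 2)).
  by field; rewrite gt_eqF.
rewrite oppr_ge0 pmulr_lle0 ?divr_gt0 ?exprn_gt0 ?ltr_wpDl //.
by move=> s2; apply/eqP; rewrite -sqrf_eq0 eq_le s2 sqr_ge0.
Qed.

End bounded.

(** * Sesquilinear forms and adjoints *)

Section representation.
Variables (R : realType) (H : hilbertType R).
Implicit Types (x y z : H) (a b : R[i]) (S T : {linear H -> H}).

Definition linear_pack (U V : lmodType R[i]) (f : U -> V) (lin_f : linear f) :
    {linear U -> V} :=
  HB.pack f (GRing.isLinear.Build R[i] U V _ f lin_f).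

(** Riesz's theorem in each second argument: the real representation gives the real
    part, and the values at i x recover the imaginary part. *)
Lemma form_representation (c : H -> H -> R[i]) (M : R) :
    (forall a x y z, c (a *: x + y) z = a * c x z + c y z) ->
    (forall a x y z, c x (a *: y + z) = a^*%C * c x y + c x z) ->
    0 <= M -> (forall x y, cmod (c x y) <= M * nrm x * nrm y) ->
  exists T, (forall x, nrm (T x) <= M * nrm x) /\
    forall x y, c x y = hdot x (T y).
Proof.
move=> cl cr M0 cM.
have c0 z : c 0 z = 0.
  apply: (addrI (c 0 z)); have := cl 1 0 0 z.
  by rewrite scale1r addr0 mul1r => <-; rewrite addr0.
have cZ a x z : c (a *: x) z = a * c x z.
  by have := cl a x 0 z; rewrite addr0 c0 addr0.
have /choice[T TP] y : exists z, forall x, c x y = hdot x z.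
  have [|||||z fz] := @real_lax_milgram R H idfun 1 (M * nrm y)
    (fun x => complex.Re (c x y)) _ ltr01.
  - by [].
  - by move=> x; rewrite mul1r rdotxx.
  - by move=> x z; rewrite -[x]scale1r cl mul1r scale1r ReD.
  - by move=> t x; rewrite cZ ReZ.
  - by move=> x; rewrite (le_trans (ler_Re_cmod _)) // mulrAC.
  exists z => x; apply/eqP; rewrite eq_complex; apply/andP; split; apply/eqP.
    exact: fz.
  rewrite -(ReMi (c x y)) -(ReMi (hdot x z)) -cZ -dotZl; exact: fz.
have Tlin : linear T.
  move=> a x y; apply: dot_inj => z.
  by rewrite -TP cr dotDr dotZr -!TP.
exists (linear_pack Tlin); split => //= x.
apply: nrm_le => [|y]; first by rewrite mulr_ge0 ?nrm_ge0.
rewrite rdotC /rdot -TP; apply: le_trans (ler_norm _) _.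
by rewrite (le_trans (ler_Re_cmod _)) // mulrAC.
Qed.

(** Working with an explicit adjoint avoids proving that the pointwise choice made by
    adj is linear; adj_unique identifies the two. *)
Definition adjoint_pair (T T' : H -> H) := forall x y, hdot (T x) y = hdot x (T' y).

Lemma adjoint_pairC (T T' : H -> H) : adjoint_pair T T' -> adjoint_pair T' T.
Proof. by move=> TT x y; rewrite dotC -TT -dotC. Qed.

Lemma adjoint_pairR (T T' : H -> H) : adjoint_pair T T' ->
  forall x y, rdot (T x) y = rdot x (T' y).
Proof. by move=> TT x y; rewrite /rdot TT. Qed.

Lemma adjoint_exists T : bounded_op T ->
  exists2 T' : {linear H -> H}, bounded_op T' & adjoint_pair T T'.
Proof.
move=> /bounded_opP[M M0 TM].
have [|||T' [T'M TT']] := @form_representation (fun x y => hdot (T x) y) M _ _ M0.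
- by move=> a x y z; rewrite linearP dotDl dotZl.
- by move=> a x y z; rewrite dotDr dotZr.
- by move=> x y; rewrite (le_trans (dot_CS _ _)) // ler_wpM2r ?nrm_ge0.
by exists T' => //; apply/bounded_opP; exists M.
Qed.

(** Lax-Milgram: T z = y holds for the minimizer z of <Tx, x> - 2 Re <x, y>. *)
Lemma coercive_surjective T (c : R) :
    adjoint_pair T T -> 0 < c -> (forall x, c * nrm x ^+ 2 <= rdot (T x) x) ->
  forall y, exists x, T x = y.
Proof.
move=> TT c0 Tc y.
have [||||x xP] := @real_lax_milgram R H T c (nrm y) (fun x => rdot x y) _ c0 Tc.
- by move=> *; rewrite /rdot TT.
- by move=> *; rewrite rdotDl.
- by move=> *; rewrite rdotZl.
- by move=> x; rewrite mulrC rdot_CS.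
by exists x; apply: rdot_inj => z; rewrite xP /rdot TT.
Qed.

(** A normal operator is used only through this equality: approximate null vectors
    of T - l are approximate null vectors of its adjoint. *)
Lemma normal_nrm (T T' : H -> H) : adjoint_pair T T' ->
  commute_op T T' -> forall x, nrm (T x) = nrm (T' x).
Proof.
move=> TT' comm x; apply/eqP; rewrite -(@eqrXn2 _ 2) ?nrm_ge0 //.
by rewrite -!rdotxx (adjoint_pairR TT') -comm (adjoint_pairR (adjoint_pairC TT')).
Qed.

Lemma commute_adjoint (S T S' T' : H -> H) : adjoint_pair S S' -> adjoint_pair T T' ->
  commute_op S T -> commute_op S' T'.
Proof.
move=> SS TT comm x; apply: dot_inj => z.
by rewrite -SS -TT -comm SS TT.
Qed.

End representation.

(** * Exactness of the Koszul complex *)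

Section koszul.
Variables (R : realType) (H : hilbertType R).
Implicit Types (x y z : H) (a b : {linear H -> H}).

(** L = a^* a + b^* b is bounded below, hence invertible, and commutes with a and b;
    the maps (u, v) |-> L^-1 (a^* u + b^* v) and y |-> (- b^* L^-1 y, a^* L^-1 y)
    then contract the Koszul complex. *)
Lemma bounded_below_koszul_exact a b (a' b' : {linear H -> H}) (d : R) :
    adjoint_pair a a' -> adjoint_pair b b' ->
    commute_op a b -> commute_op a a' -> commute_op b b' -> commute_op a b' ->
    0 < d -> (forall x, d * nrm x <= nrm (a x) + nrm (b x)) ->
  koszul_exact a b.
Proof.
move=> aa bb ab caa cbb cab' d0 dP.
have ca'b : commute_op a' b by apply: commute_adjoint cab' => //; exact: adjoint_pairC.
have Llin : linear (fun x => a' (a x) + b' (b x)).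
  by move=> k x y; rewrite !linearP scalerDr addrACA.
pose L := linear_pack Llin.
have LL : adjoint_pair L L.
  move=> x y /=; rewrite dotDl dotDr; congr (_ + _).
    by rewrite (adjoint_pairC aa) aa.
  by rewrite (adjoint_pairC bb) bb.
have Lc x : d ^+ 2 / 2 * nrm x ^+ 2 <= rdot (L x) x.
  rewrite /= rdotDl (adjoint_pairR (adjoint_pairC aa)) (adjoint_pairR (adjoint_pairC bb)).
  rewrite !rdotxx.
  have : (d * nrm x) ^+ 2 <= (nrm (a x) + nrm (b x)) ^+ 2.
    by rewrite ler_pXn2r ?nnegrE ?addr_ge0 ?mulr_ge0 ?nrm_ge0 // ltW.
  rewrite exprMn; have := sqr_ge0 (nrm (a x) - nrm (b x)); lra.
have d2 : 0 < d ^+ 2 / 2 by rewrite divr_gt0 ?exprn_gt0.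
have Lsurj := coercive_surjective LL d2 Lc.
have Linj x y : L x = L y -> x = y.
  move=> Lxy; apply/eqP; rewrite -subr_eq0; apply/eqP/nrm_eq0/eqP.
  rewrite -sqrf_eq0 eq_le sqr_ge0 andbT -(pmulr_rle0 _ d2).
  by apply: le_trans (Lc _) _; rewrite linearB Lxy subrr /rdot dot0l.
split.
- move=> x [ax bx]; apply: Linj; rewrite linear0.
  by change (a' (a x) + b' (b x) = 0); rewrite ax bx !linear0 addr0.
- apply/seteqP; split=> [_ [x _ <-]|[u v]] /=.
    by rewrite /koszul1 /koszul0 /= ab subrr.
  rewrite /koszul1 /= => /eqP; rewrite subr_eq0 => /eqP auv.
  have [x Lx] := Lsurj (a' u + b' v).
  have ax : a x = u.
    apply: Linj; transitivity (a (L x)).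
      by rewrite /= linearD -/(commute_op _ _) caa cab' ab.
    by rewrite Lx linearD caa cab' auv.
  have bx : b x = v.
    apply: Linj; transitivity (b (L x)).
      by rewrite /= linearD cbb -ca'b ab.
    by rewrite Lx linearD cbb -ca'b -auv.
  by exists x; rewrite // /koszul0 ax bx.
- apply/seteqP; split=> // y _; have [x <-] := Lsurj y.
  exists (- b' x, a' x) => //.
  by rewrite /koszul1 /= linearN opprK caa cbb.
Qed.

(** A gliding hump: each step of length 3 ^- n outweighs all the later ones. *)
Lemma gliding_hump (e : nat -> H) : (forall n, nrm (e n) = 1) ->
  exists y, forall n, 3 ^- n / 2 <= `|rdot y (e n)|.
Proof.
move=> e1.
pose sg y n : R := if 0 <= rdot y (e n) then 3 ^- n else - 3 ^- n.
pose u := fix u n := if n is m.+1 then u m + (sg (u m) m)%:C *: e m else 0.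
have p3 n : 0 < 3 ^- n :> R by rewrite invr_gt0 exprn_gt0.
have usg n : `|sg (u n) n| = 3 ^- n.
  by rewrite /sg; case: ifP => _; rewrite ?normrN gtr0_norm.
have ue n : 3 ^- n <= `|rdot (u n.+1) (e n)|.
  rewrite /= rdotDl rdotZl rdotxx e1 expr1n mulr1 /sg.
  have := p3 n; case: ifP => [h|/negbT].
    by rewrite ger0_norm ?addr_ge0 // ?lerDr // ltW.
  rewrite -ltNge => h h3; rewrite ltr0_norm ?opprD ?opprK.
    by rewrite lerDr oppr_ge0 ltW.
  by lra.
have ud n k : nrm (u (n + k)%N - u n) <= 3 / 2 * (3 ^- n - 3 ^- (n + k)).
  elim: k => [|k IH]; first by rewrite addn0 !subrr nrm0 mulr0.
  rewrite addnS [u _.+1]/= addrAC.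
  apply: le_trans (nrmD _ _) _; rewrite nrmZR usg e1 mulr1.
  have -> : 3 ^- (n + k).+1 = 3 ^- (n + k) / 3 :> R.
    by rewrite exprS invfM mulrC.
  by move: IH; lra.
have ud' m n : (n <= m)%N -> nrm (u m - u n) <= 3 / 2 * 3 ^- n.
  move=> /subnKC <-; apply: le_trans (ud _ _) _.
  by rewrite ler_pM2l // gerBl ltW.
have [|y uy] := @cauchy_nrm_converges R H u.
  move=> d d0.
  have [N hN] := exists_inv_lt (divr_gt0 d0 (ltr0n R 3)).
  have h3 : 3 ^- N < d / 3.
    apply: le_lt_trans (hN N (leqnn _)).
    by rewrite lef_pV2 ?posrE ?exprn_gt0 // -natrX ler_nat ltn_expl.
  exists N => m n Nm Nn.
  have -> : u m - u n = (u m - u N) - (u n - u N) by rewrite opprB addrA subrK.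
  apply: le_lt_trans (nrmB _ _) _.
  by have := ud' _ _ Nm; have := ud' _ _ Nn; lra.
exists y => n.
have h : nrm (u n.+1 - y) <= 3 ^- n / 2.
  apply/ler_addgt0Pl => d d0.
  have [N hN] := uy _ d0.
  have := hN _ (leq_maxl N n.+1); have := ud' _ _ (leq_maxr N n.+1).
  set m := maxn _ _ => h1 h2.
  have -> : u n.+1 - y = (u m - y) - (u m - u n.+1).
    by rewrite opprB [RHS]addrC addrA subrK.
  apply: le_trans (nrmB _ _) _; apply: lerD; first exact: ltW.
  apply: le_trans h1 _.
  by rewrite exprS invfM; lra.
have -> : y = u n.+1 - (u n.+1 - y) by rewrite opprB [RHS]addrC subrK.
rewrite rdotDl rdotNl.
have := rdot_CS (u n.+1 - y) (e n); rewrite e1 mulr1.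
move: (ue n) (ler_normD (rdot (u n.+1) (e n) - rdot (u n.+1 - y) (e n))
  (rdot (u n.+1 - y) (e n))).
by rewrite subrK; lra.
Qed.
End koszul.

(** * Approximate null vectors *)

Section approximate_null.
Variables (R : realType) (H : hilbertType R).
Implicit Types (x y z : H) (a b T : {linear H -> H}) (g : H -> R).

(** The functional g adds up the errors with which a vector fails to be a joint
    eigenvector, so the vectors x below play the role of common eigenvectors. *)
Definition approx_null g := forall e : R, 0 < e -> exists2 x, x != 0 & g x <= e * nrm x.

(** If every y were a v - b u, then <y, e n> would tend to 0 as fast as a (e n) and
    b (e n) do, for any unit vectors e n; a gliding hump excludes this when the
    decay 6 ^- n beats 3 ^- n. *)
Lemma approx_null_not_exact a b (a' b' : H -> H) :
    adjoint_pair a a' -> adjoint_pair b b' -> commute_op a a' -> commute_op b b' ->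
    approx_null (fun x => nrm (a x) + nrm (b x)) ->
  ~ koszul_exact a b.
Proof.
move=> aa bb caa cbb ab0 [_ _ surj].
have /choice[e eP] (n : nat) : exists x, nrm x = 1 /\ nrm (a x) + nrm (b x) <= 6 ^- n.
  have [|x x0 xP] := ab0 (6 ^- n); first by rewrite invr_gt0 exprn_gt0.
  have nx := nrm_gt0 x0.
  exists ((nrm x)^-1%:C *: x); rewrite !linearZ /= !nrmZR gtr0_norm ?invr_gt0 //.
  rewrite mulVf ?gt_eqF //; split => //.
  by rewrite -mulrDr mulrC ler_pdivrMr.
have [y yP] := gliding_hump (fun n => (eP n).1).
have : [set: H] y by [].
rewrite -surj => -[[u v] _]; rewrite /koszul1 /= => y_def.
have ye n : `|rdot y (e n)| <= (nrm u + nrm v) * 6 ^- n.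
  rewrite -y_def rdotDl rdotNl (adjoint_pairR aa) (adjoint_pairR bb).
  apply: le_trans (ler_normB _ _) _.
  have := rdot_CS v (a' (e n)); have := rdot_CS u (b' (e n)).
  rewrite -(normal_nrm aa caa) -(normal_nrm bb cbb).
  have [_ ab6] := eP n.
  have a6 : nrm (a (e n)) <= 6 ^- n by apply: le_trans ab6; rewrite lerDl nrm_ge0.
  have b6 : nrm (b (e n)) <= 6 ^- n by apply: le_trans ab6; rewrite lerDr nrm_ge0.
  have := ler_wpM2l (nrm_ge0 v) a6; have := ler_wpM2l (nrm_ge0 u) b6.
  by rewrite mulrDl; lra.
have bd n : (n%:R : R) <= (nrm u + nrm v) * 2.
  apply: (@le_trans _ _ (2 ^+ n)).
    by rewrite -natrX ler_nat ltnW // ltn_expl.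
  have := le_trans (yP n) (ye n).
  have -> : 6 = 3 * 2 :> R by ring.
  rewrite exprMn invfM -[_ / 2 <= _](ler_pM2r (_ : 0 < 3 ^+ n * 2 ^+ n * 2)); last first.
    by rewrite !mulr_gt0 ?exprn_gt0.
  have := lt0r_neq0 (exprn_gt0 n (ltr0n R 3)); have := lt0r_neq0 (exprn_gt0 n (ltr0n R 2)).
  move: (2 ^+ n) (3 ^+ n) => p q p0 q0.
  have -> : q^-1 / 2 * (q * p * 2) = p by field.
  suff -> : (nrm u + nrm v) * (q^-1 / p) * (q * p * 2) = (nrm u + nrm v) * 2 by [].
  by field; rewrite p0 q0.
have := bd (Num.truncn ((nrm u + nrm v) * 2)).+1.
by rewrite leNgt truncnS_gt.
Qed.

(** Along T^k x the ratios of consecutive squared norms increase, by normality,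
    and stay bounded, so some two consecutive ones almost agree; the equality
    case of the Cauchy-Schwarz inequality then makes T^k x an approximate
    eigenvector of T^* T. *)
Lemma power_step T (T' : H -> H) (M r d : R) x :
    adjoint_pair T T' -> commute_op T T' ->
    (forall x, nrm (T x) <= M * nrm x) -> 0 < r -> r * nrm x <= nrm (T x) ->
    x != 0 -> 0 < d ->
  forall N : nat, M ^+ 4 <= d ^+ 2 * N%:R -> exists k : nat, [/\ (k <= N)%N,
    r ^+ k * nrm x <= nrm (iter k T x), iter k T x != 0 &
    exists rho : R, [/\ r ^+ 2 <= rho, rho <= M ^+ 2 &
      nrm (T' (T (iter k T x)) - rho%:C *: iter k T x) <= d * nrm (iter k T x)]].
Proof.
move=> TT' comm TM r0 rx x0 d0 N MN.
pose y k := iter k T x; pose n k := nrm (y k).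
have yS k : T (y k) = y k.+1 by [].
have convex k : n k.+1 ^+ 2 <= n k.+2 * n k.
  rewrite /n -rdotxx -[in X in rdot X _]yS (adjoint_pairR TT') rdotC.
  apply: le_trans (ler_norm _) _; apply: le_trans (rdot_CS _ _) _.
  by rewrite -(normal_nrm TT' comm) yS.
have nr k : 0 < n k /\ r * n k <= n k.+1.
  elim: k => [|k [nk IH]]; first by split; [exact: nrm_gt0|].
  have nk1 : 0 < n k.+1 by apply: lt_le_trans IH; rewrite mulr_gt0.
  split => //; rewrite -(ler_pM2r nk); apply: le_trans (convex k).
  by rewrite expr2 mulrAC ler_pM2r.
have n0 k : 0 < n k by case: (nr k).
have M0 : 0 <= M.
  by rewrite -(pmulr_lge0 _ (n0 0%N)); apply: le_trans (TM _); exact: nrm_ge0.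
have ny k : r ^+ k * n 0%N <= n k.
  elim: k => [|k IH]; first by rewrite mul1r.
  by apply: le_trans (nr k).2; rewrite exprS -mulrA ler_pM2l.
pose rho k := (n k.+1 / n k) ^+ 2.
have rho_ge k : r ^+ 2 <= rho k.
  rewrite /rho ler_pXn2r ?nnegrE ?divr_ge0 ?(ltW (n0 _)) ?(ltW r0) //.
  by rewrite ler_pdivlMr //; exact: (nr k).2.
have rho_le k : rho k <= M ^+ 2.
  rewrite /rho ler_pXn2r ?nnegrE ?divr_ge0 ?(ltW (n0 _)) //.
  by rewrite ler_pdivrMr //; exact: TM.
(* If all increments of rho exceeded d^2 / M^2, then rho would leave [r^2, M^2]
   before step N. *)
have [k kN kP] : exists2 k, (k <= N)%N & M ^+ 2 * (rho k.+1 - rho k) <= d ^+ 2.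
  apply: contrapT => noK.
  have inc k : (k <= N)%N -> M ^+ 2 * (rho k - rho 0%N) >= d ^+ 2 * k%:R.
    elim: k => [_|k IH kN]; first by rewrite subrr !mulr0.
    have := IH (ltnW kN).
    have : d ^+ 2 < M ^+ 2 * (rho k.+1 - rho k).
      by rewrite ltNge; apply/negP => kP; apply: noK; exists k => //; exact: ltnW.
    by rewrite -natr1; lra.
  have M2 : 0 < M ^+ 2.
    apply: lt_le_trans (rho_le 0%N); apply: lt_le_trans (rho_ge 0%N).
    by rewrite exprn_gt0.
  have := le_trans MN (inc N (leqnn _)).
  have -> : M ^+ 4 = M ^+ 2 * M ^+ 2 by rewrite -exprD.
  rewrite ler_pM2l // => MN2; have := rho_le N; have := rho_ge 0%N.
  have : 0 < r ^+ 2 by rewrite exprn_gt0.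
  by lra.
exists k; split; [exact: kN|exact: ny| |].
  by apply: contraTneq (n0 k) => yk; rewrite /n /y yk nrm0 ltxx.
exists (rho k); split=> //; rewrite -/(y k).
rewrite -(@ler_pXn2r _ 2) ?nnegrE ?mulr_ge0 ?nrm_ge0 ?(ltW d0) //.
rewrite sqr_nrmB rdotZr (adjoint_pairR (adjoint_pairC TT')) rdotxx nrmZR.
rewrite -(normal_nrm TT' comm) exprMn real_normK ?num_real // !yS -!/(n _).
apply: (@le_trans _ _ (n k ^+ 2 * (M ^+ 2 * (rho k.+1 - rho k)))); last first.
  by rewrite [leRHS]exprMn mulrC ler_pM2r // exprn_gt0.
have -> : n k.+2 ^+ 2 - rho k * n k.+1 ^+ 2 *+ 2 + rho k ^+ 2 * n k ^+ 2
   = n k ^+ 2 * (rho k * (rho k.+1 - rho k)).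
  rewrite /rho; move: (n0 k) (n0 k.+1).
  by move: (n k) (n k.+1) (n k.+2) => p q s p0 q0; field; rewrite !gt_eqF.
rewrite ler_pM2l ?exprn_gt0 // ler_wpM2r // subr_ge0.
rewrite /rho ler_pXn2r ?nnegrE ?divr_ge0 ?(ltW (n0 _)) //.
by rewrite ler_pdivlMr // mulrAC ler_pdivrMr // -expr2.
Qed.
End approximate_null.

(** * Approximate eigenvalues of normal operators *)

Section approximate_eigenvalue.
Variables (R : realType) (H : hilbertType R).
Implicit Types (x y z : H) (T E : {linear H -> H}) (g : H -> R).

(** Since g grows at most geometrically along the powers of T, it may be made small at
    T^k x by choosing x after the bound N on k. The values rho found for each precision
    stay in a compact interval, and a cluster point of them serves all precisions. *)
Lemma approx_null_power T (T' : H -> H) (r K : R) g :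
    adjoint_pair T T' -> commute_op T T' -> bounded_op T -> 0 < r -> 0 < K ->
    (forall x, g (T x) <= K * g x) ->
    (forall e : R, 0 < e ->
      exists x, [/\ x != 0, g x <= e * nrm x & r * nrm x <= nrm (T x)]) ->
  exists2 rho : R, r ^+ 2 <= rho &
    approx_null (fun x => g x + nrm (T' (T x) - rho%:C *: x)).
Proof.
move=> TT' comm /bounded_opP[M M0 TM] r0 K0 gT gr.
have step (e : R) : 0 < e -> exists rho : R, [/\ r ^+ 2 <= rho, rho <= M ^+ 2 &
    exists x, [/\ x != 0, g x <= e * nrm x & nrm (T' (T x) - rho%:C *: x) <= e * nrm x]].
  move=> e0; pose N := (Num.truncn (M ^+ 4 / e ^+ 2)).+1.
  have MN : M ^+ 4 <= e ^+ 2 * N%:R.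
    by rewrite mulrC -ler_pdivrMr ?exprn_gt0 // ltW // truncnS_gt.
  (* T^k x keeps at least r^k of the norm of x while g grows by at most K^k, for
     every k <= N. *)
  pose q := Num.min 1 (r / K).
  have q0 : 0 < q by rewrite lt_min ltr01 divr_gt0.
  have [|x [x0 gx rx]] := gr (e * q ^+ N); first by rewrite mulr_gt0 ?exprn_gt0.
  have [k [kN rk xk [rho [rho_ge rho_le rhoP]]]] :=
    power_step TT' comm TM r0 rx x0 e0 MN.
  exists rho; split=> //; exists (iter k T x); split=> //.
  have gk : g (iter k T x) <= K ^+ k * g x.
    elim: (k) => [|j IH]; first by rewrite mul1r.
    by apply: le_trans (gT _) _; rewrite exprS -mulrA ler_pM2l.
  apply: le_trans gk _; apply: le_trans (ler_wpM2l _ gx) _.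
    by rewrite exprn_ge0 // ltW.
  apply: (@le_trans _ _ (e * (r ^+ k * nrm x))); last by rewrite ler_pM2l.
  rewrite !mulrA ler_wpM2r ?nrm_ge0 // [_ * e]mulrC -!mulrA ler_pM2l // mulrC.
  apply: (@le_trans _ _ ((r / K) ^+ k * K ^+ k)); last first.
    by rewrite -exprMn divfK // gt_eqF.
  rewrite ler_wpM2r ?exprn_ge0 ?(ltW K0) //.
  apply: (@le_trans _ _ (q ^+ k)).
    by rewrite ler_wiXn2l ?(ltW q0) // ge_min lexx.
  apply: lerXn2r; rewrite ?nnegrE ?divr_ge0 ?(ltW q0) ?(ltW r0) ?(ltW K0) //.
  by rewrite ge_min lexx orbT.
have inv_gt0 (n : nat) : 0 < n.+1%:R^-1 :> R by rewrite invr_gt0.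
have /choice[rho rhoP] (n : nat) := step _ (inv_gt0 n).
have [|s [_ s_cluster]] := @segment_compact R (r ^+ 2) (M ^+ 2) (rho @ \oo) _.
  by exists 0%N => // n _ /=; rewrite in_itv /=; have [-> ->] := rhoP n.
have s_near (e : R) (N : nat) : 0 < e -> exists2 n, (N <= n)%N & `|s - rho n| < e.
  move=> e0.
  have [||t [[n Nn <-] /= nt]] :=
      s_cluster (rho @` [set n | (N <= n)%N]) (ball s e).
  - by exists N => // n /= Nn; exists n.
  - exact: nbhsx_ballx.
  by exists n.
exists s.
  apply/ler_addgt0Pr => e e0; have [n _] := s_near e 0%N e0.
  by rewrite ltr_norml => /andP[sn _]; have [rn _ _] := rhoP n; lra.
move=> e e0; have e3 : 0 < e / 3 by rewrite divr_gt0.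
have [N hN] := exists_inv_lt e3.
have [n Nn sn] := s_near _ N e3.
have [_ _ [x [x0 gx Tx]]] := rhoP n; exists x => //.
have x_gt0 := nrm_gt0 x0; have := hN n Nn; rewrite -(ltr_pM2r x_gt0) => h.
have -> : T' (T x) - s%:C *: x = (T' (T x) - (rho n)%:C *: x) - (s - rho n)%:C *: x.
  by rewrite rmorphB scalerBl opprB addrA subrK.
have := nrmB (T' (T x) - (rho n)%:C *: x) ((s - rho n)%:C *: x).
rewrite nrmZR; move: sn; rewrite -(ltr_pM2r x_gt0).
move: gx Tx h; move: (n.+1%:R^-1 * nrm x) => p; lra.
Qed.

(** The error functionals g along which approximate null vectors are sought stay
    controlled under every polynomial in T. *)
Definition stable_under (T : H -> H) g :=
  forall c : R[i], exists2 K : R, 0 < K & forall x, g (T x + c *: x) <= K * g x.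

Lemma stable_under_nrm E (T : {linear H -> H}) :
  bounded_op T -> commute_op E T -> stable_under T (fun x => nrm (E x)).
Proof.
move=> /bounded_opP[M M0 TM] ET c; exists (M + cmod c + 1).
  by rewrite ltr_wpDl // addr_ge0 // cmod_ge0.
move=> x; rewrite linearD linearZ /= ET.
apply: le_trans (nrmD _ _) _; rewrite nrmZ !mulrDl mul1r.
by have := TM (E x); have := nrm_ge0 (E x); lra.
Qed.

Lemma stable_under_add (T : H -> H) g h :
    (forall x, 0 <= g x) -> (forall x, 0 <= h x) ->
  stable_under T g -> stable_under T h -> stable_under T (fun x => g x + h x).
Proof.
move=> g0 h0 gT hT c; have [K K0 gK] := gT c; have [L L0 hL] := hT c.
exists (K + L); first exact: addr_gt0.
move=> x; apply: le_trans (lerD (gK x) (hL x)) _.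
rewrite mulrDl !mulrDr; have := mulr_ge0 (ltW K0) (h0 x); have := mulr_ge0 (ltW L0) (g0 x).
lra.
Qed.

Lemma shift_linear T (c : R[i]) : linear (fun x => T x + c *: x).
Proof.
by move=> a x y; rewrite linearP !scalerDr !scalerA [c * a]mulrC addrACA.
Qed.

Lemma adjoint_pair_shift T T' (c : R[i]) : adjoint_pair T T' ->
  adjoint_pair (fun x => T x + c *: x) (fun x => T' x + c^*%C *: x).
Proof.
move=> TT x y; rewrite dotDl dotDr dotZl dotZr TT; congr (_ + _ * _).
exact/esym/conjcK.
Qed.

Lemma commute_shift (S T : {linear H -> H}) (a b : R[i]) : commute_op S T ->
  commute_op (fun x => S x + a *: x) (fun x => T x + b *: x).
Proof.
move=> ST x /=; rewrite (linearD S) (linearD T) !linearZ_LR /= ST !scalerDr !scalerA.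
by rewrite [a * b]mulrC addrACA [b *: _ + _]addrC -addrACA.
Qed.

Lemma bounded_shift T (c : R[i]) : bounded_op T -> bounded_op (fun x => T x + c *: x).
Proof.
move=> /bounded_opP[M M0 TM]; apply/bounded_opP; exists (M + cmod c).
  by rewrite addr_ge0 // cmod_ge0.
move=> x; apply: le_trans (nrmD _ _) _; rewrite nrmZ mulrDl.
by rewrite lerD2r.
Qed.

(** Polarization writes T as a combination of the four positive operators
    (T + c)^* (T + c) with |c| = |T| + 1, and each T + c is bounded below. *)
Lemma approx_null_eigenvalue T (T' : {linear H -> H}) g :
    adjoint_pair T T' -> commute_op T T' -> bounded_op T ->
    (forall x, 0 <= g x) -> stable_under T g -> approx_null g ->
  exists l : R[i], approx_null (fun x => g x + nrm (T x - l *: x)).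
Proof.
move=> TT' comm Tb g0 gT gn.
have /bounded_opP[M M0 TM] := Tb.
pose k := M + 1; have k1 : 1 <= k by rewrite /k lerDr.
have k0 : 0 < k by apply: lt_le_trans k1.
pose G (c : R[i]) rho x := T' (T x + c *: x) + c^*%C *: (T x + c *: x) - rho%:C *: x.
have step (c : R[i]) h : cmod c = k -> (forall x, 0 <= h x) -> stable_under T h ->
    approx_null h -> exists rho : R,
      [/\ forall x, 0 <= h x + nrm (G c rho x),
          stable_under T (fun x => h x + nrm (G c rho x)) &
    approx_null (fun x => h x + nrm (G c rho x))].
  move=> ck h0 hT hn.
  have [K K0 hK] := hT c.
  pose Tc := linear_pack (shift_linear T c).
  pose Tc' := linear_pack (shift_linear T' c^*%C).
  have [|e e0|rho _ rhon] := @approx_null_power Tc Tc' 1 K h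
     (adjoint_pair_shift c TT') (commute_shift c c^*%C comm) _ ltr01 K0 hK.
  - exact: bounded_shift.
  - have [x x0 hx] := hn _ e0; exists x; split => //; rewrite mul1r /=.
    have -> : T x + c *: x = c *: x - - T x by rewrite opprK addrC.
    have := nrmD (T x + c *: x) (- T x); rewrite nrmN addrAC subrr add0r nrmZ ck.
    rewrite opprK [_ + T x]addrC.
    by have := TM x; rewrite /k mulrDl mul1r; lra.
  exists rho; split => //.
    by move=> x; rewrite addr_ge0 ?nrm_ge0.
  apply: stable_under_add => // [x|]; first exact: nrm_ge0.
  have Glin : linear (G c rho).
    move=> a x y; rewrite /G -!/(Tc' _) -!/(Tc _).
    change (Tc' (Tc (a *: x + y)) - rho%:C *: (a *: x + y) =
       a *: (Tc' (Tc x) - rho%:C *: x) + (Tc' (Tc y) - rho%:C *: y)).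
    rewrite (linearP Tc) (linearP Tc') scalerBr !scalerDr !scalerA [a * _]mulrC opprD.
    by rewrite addrACA.
  apply: (@stable_under_nrm (linear_pack Glin)) => // x /=.
  rewrite /G !linearB /= !linearD !linearZ /= comm.
  by rewrite comm !scalerA [c * _]mulrC.
have ki : cmod ('i%C * k%:C) = k by rewrite Normc.normcM cmodi mul1r cmodR gtr0_norm.
have kk : cmod k%:C = k by rewrite cmodR gtr0_norm.
have [r1 [g1 gT1 gn1]] := step _ _ kk g0 gT gn.
have [r2 [g2 gT2 gn2]] := step _ _ (etrans (cmodN _) kk) g1 gT1 gn1.
have [r3 [g3 gT3 gn3]] := step _ _ ki g2 gT2 gn2.
have [r4 [_ _ gn4]] := step _ _ (etrans (cmodN _) ki) g3 gT3 gn3.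
(* 4 k T is the sum of i^j (T + i^j k)^* (T + i^j k) over j < 4. *)
pose l : R[i] := (4 * k)^-1%:C * (r1%:C - r2%:C + 'i%C * (r3%:C - r4%:C)).
exists l => e e0; have [x x0 xP] := gn4 _ e0; exists x => //.
apply: le_trans xP; rewrite -!addrA lerD2l.
have -> : T x - l *: x = (4 * k)^-1%:C *: ((G k%:C r1 x - G (- k%:C) r2 x) +
     'i%C *: (G ('i%C * k%:C) r3 x - G (- ('i%C * k%:C)) r4 x)).
  have Gdiff c r r' : G c r x - G (- c) r' x =
      (2 * c) *: T' x + (2 * c^*%C) *: T x - (r%:C - r'%:C) *: x.
    rewrite /G !(linearD T') !(linearZ_LR T') /=; apply: dot_injl => z.
    by rewrite !(dotDl, dotNl, dotZl) rmorphN /=; ring.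
  have iJ : ('i%C * k%:C)^*%C = - ('i%C * k%:C).
    by apply/eqP; rewrite eq_complex /=; apply/andP; split; apply/eqP; ring.
  rewrite !Gdiff iJ conjc_real; apply: dot_injl => z.
  have kC0 : k%:C != 0 by rewrite eq_complex /= gt_eqF.
  have ii : 'i%C * 'i%C = -1 :> R[i] by rewrite -expr2 sqr_i.
  rewrite /l fmorphV rmorphM /= !(dotDl, dotNl, dotZl).
  have -> : 4%:C = 4 :> R[i] by rewrite (rmorph_nat _ 4).
  move: 'i%C ii => i ii; move: k%:C r1%:C r2%:C r3%:C r4%:C kC0 => K a b c d K0.
  move: (hdot (T x) z) (hdot (T' x) z) (hdot x z) => X Y Z.
  have -> : i * (2 * (i * K) * Y + 2 * - (i * K) * X - (c - d) * Z) =
     (i * i) * (2 * K * Y - 2 * K * X) - i * (c - d) * Z by ring.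
  by rewrite ii; field.
rewrite nrmZR ger0_norm ?invr_ge0 ?mulr_ge0 ?(ltW k0) // mulrC.
rewrite ler_pdivrMr ?mulr_gt0 //.
apply: le_trans (nrmD _ _) _; rewrite nrmZ cmodi mul1r.
have := nrmB (G k%:C r1 x) (G (- k%:C) r2 x).
have := nrmB (G ('i%C * k%:C) r3 x) (G (- ('i%C * k%:C)) r4 x).
have := nrm_ge0 (G k%:C r1 x); have := nrm_ge0 (G (- k%:C) r2 x).
have := nrm_ge0 (G ('i%C * k%:C) r3 x); have := nrm_ge0 (G (- ('i%C * k%:C)) r4 x).
move: (nrm (G _ _ _)) (nrm (G _ _ _)) (nrm (G _ _ _)) (nrm (G _ _ _)).
move=> p q s t p0 q0 s0 t0 h1 h2.
have : 0 <= (p + q + s + t) * (4 * k - 1) by apply: mulr_ge0; lra.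
by move: h1 h2; lra.
Qed.
End approximate_eigenvalue.

Section approximate_spectrum.
Variables (R : realType) (H : hilbertType R).
Implicit Types (x y z : H) (S T E : {linear H -> H}) (g h : H -> R).

Lemma approx_null_le g h : (forall x, h x <= g x) -> approx_null g -> approx_null h.
Proof.
move=> hg gn e e0; have [x x0 gx] := gn e e0.
by exists x => //; apply: le_trans gx.
Qed.

(** The tool by which an identity between approximate eigenvalues is proved: a is the
    modulus of its defect, which g controls. *)
Lemma approx_null_bound g (a K : R) :
    approx_null g -> 0 < K -> (forall x, a * nrm x <= K * g x) -> a <= 0.
Proof.
move=> gn K0 aK; rewrite leNgt; apply/negP => a0.
have [x x0 gx] := gn (a / 2 / K) (divr_gt0 (divr_gt0 a0 (ltr0n R 2)) K0).
have := mulr_gt0 a0 (nrm_gt0 x0); have := aK x.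
have : K * g x <= a * nrm x / 2.
  apply: le_trans (ler_wpM2l (ltW K0) gx) _.
  by rewrite mulrA [K * _]mulrC divfK ?gt_eqF // mulrAC.
by move: (a * nrm x) (K * g x) => p q; lra.
Qed.

Lemma eigenvalue_gap_le (T : {linear H -> H}) (a b : R[i]) x :
  cmod (a - b) * nrm x <= nrm (T x - a *: x) + nrm (T x - b *: x).
Proof.
rewrite -nrmZ.
have -> : (a - b) *: x = (T x - b *: x) - (T x - a *: x).
  by rewrite scalerBl opprB [RHS]addrC addrA subrK.
by rewrite [leRHS]addrC nrmB.
Qed.

Lemma shift_opp T (c : R[i]) : (fun x => T x + (- c) *: x) = (fun x => T x - c *: x).
Proof. by apply/funext => x; rewrite scaleNr. Qed.

Lemma normal_nrm_shift T (T' : {linear H -> H}) (l : R[i]) :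
    adjoint_pair T T' -> commute_op T T' ->
  forall x, nrm (T' x - l^*%C *: x) = nrm (T x - l *: x).
Proof.
move=> TT' comm x.
pose Tl := linear_pack (shift_linear T (- l)).
pose Tl' := linear_pack (shift_linear T' (- l)^*%C).
have := @normal_nrm R H Tl Tl' (adjoint_pair_shift _ TT') (commute_shift _ _ comm) x.
by rewrite /= scaleNr => ->; rewrite rmorphN scaleNr.
Qed.

Lemma shiftN_linear T (c : R[i]) : linear (fun x => T x - c *: x).
Proof. by rewrite -shift_opp; exact: shift_linear. Qed.

Lemma stable_under_eigen S T (c : R[i]) : bounded_op S -> commute_op T S ->
  stable_under S (fun x => nrm (T x - c *: x)).
Proof.
move=> Sb TS; apply: (@stable_under_nrm _ _ (linear_pack (shiftN_linear T c))) => // x /=.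
by rewrite TS (linearB S) (linearZ_LR S).
Qed.

(** A normal operator that stretches some vector by r has an approximate
    eigenvalue of modulus at least r. *)
Lemma large_approximate_eigenvalue T (T' : {linear H -> H}) (r : R) x :
    adjoint_pair T T' -> commute_op T T' -> bounded_op T -> 0 < r ->
    x != 0 -> r * nrm x <= nrm (T x) ->
  exists2 l : R[i], r <= cmod l & approx_null (fun y => nrm (T y - l *: y)).
Proof.
move=> TT' comm Tb r0 x0 rx.
have [|e e0|rho rho_ge rhon] :=
    @approx_null_power R H T T' r 1 (fun=> 0) TT' comm Tb r0 ltr01.
- by move=> y; rewrite mulr0.
- by exists x; split=> //; rewrite mulr_ge0 ?nrm_ge0 // ltW.
pose A := T' \o T; have Ast : stable_under T (fun y => nrm (A y - rho%:C *: y)).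
  apply: (@stable_under_eigen T (linear_pack (linearP A)) rho%:C) => // y /=.
  by rewrite comm.
have An : approx_null (fun y => nrm (A y - rho%:C *: y)).
  by apply: approx_null_le rhon => y; rewrite add0r.
have [l ln] := approx_null_eigenvalue TT' comm Tb (fun=> nrm_ge0 _) Ast An.
exists l; last by apply: approx_null_le ln => y; rewrite lerDr nrm_ge0.
have /bounded_opP[M M0 T'M] : bounded_op T'.
  have /bounded_opP[M M0 TM] := Tb; apply/bounded_opP; exists M => // y.
  by rewrite -(normal_nrm TT' comm).
have T'l := normal_nrm_shift l TT' comm.
suff : rho - cmod l ^+ 2 <= 0.
  rewrite subr_le0 => /(le_trans rho_ge).
  by rewrite ler_pXn2r ?nnegrE ?cmod_ge0 // ltW.
apply: (approx_null_bound (K := 1 + M + cmod l) ln).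
  by rewrite -addrA ltr_wpDr // addr_ge0 // cmod_ge0.
move=> y.
apply: (@le_trans _ _ (nrm ((rho%:C - (cmod l ^+ 2)%:C) *: y))).
  by rewrite -rmorphB nrmZR ler_wpM2r ?nrm_ge0 // ler_norm.
have -> : (rho%:C - (cmod l ^+ 2)%:C) *: y =
    T' (T y - l *: y) + l *: (T' y - l^*%C *: y) - (A y - rho%:C *: y).
  rewrite /A (linearB T') (linearZ_LR T') /=; apply: dot_injl => z.
  by rewrite -mulCJ !(dotDl, dotNl, dotZl); ring.
apply: le_trans (nrmB _ _) _; rewrite !mulrDl mul1r mulrDr mulrDr.
have := nrmD (T' (T y - l *: y)) (l *: (T' y - l^*%C *: y)).
rewrite nrmZ T'l; have := T'M (T y - l *: y).
have := nrm_ge0 (T y - l *: y); have := nrm_ge0 (A y - rho%:C *: y).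
have := mulr_ge0 M0 (nrm_ge0 (A y - rho%:C *: y)).
have := mulr_ge0 (cmod_ge0 l) (nrm_ge0 (A y - rho%:C *: y)).
by lra.
Qed.
End approximate_spectrum.

(** * Gamma-unitaries satisfy S = S^* P, |P x| = |x| and |S| <= 2 *)

Section Gamma_unitary_relations.
Variables (R : realType) (N : hilbertType R) (S P : {linear N -> N}).
Hypothesis SPu : Gamma_unitary S P.
Implicit Types (x y z : N) (g h : N -> R).

(** An approximate null family that is stable under S and P contains joint
    approximate eigenvectors, and the Koszul complex cannot be exact at the
    corresponding point. *)
Lemma joint_spectral_point g :
    (forall x, 0 <= g x) -> stable_under S g -> stable_under P g -> approx_null g ->
  exists l1 l2 : R[i], bGamma (l1, l2) /\
    approx_null (fun x => g x + nrm (P x - l2 *: x) + nrm (S x - l1 *: x)).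
Proof.
move=> g0 gS gP gn; have [[Sb Pb] SP [Sn Pn] spec] := SPu.
have [S' S'b SS'] := adjoint_exists Sb; have [P' P'b PP'] := adjoint_exists Pb.
rewrite /normal_op (adj_unique SS') in Sn; rewrite /normal_op (adj_unique PP') in Pn.
have [l2 gn2] := approx_null_eigenvalue PP' Pn Pb g0 gP gn.
have gS2 : stable_under S (fun x => g x + nrm (P x - l2 *: x)).
  apply: stable_under_add => // [x|]; first exact: nrm_ge0.
  by apply: stable_under_eigen => // x; rewrite SP.
have [|l1 gn1] := approx_null_eigenvalue SS' Sn Sb _ gS2 gn2.
  by move=> x; rewrite addr_ge0 ?nrm_ge0.
exists l1, l2; split => //; apply: spec; rewrite /taylor_spectrum /=.
pose a := linear_pack (shiftN_linear S l1); pose b := linear_pack (shiftN_linear P l2).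
pose a' := linear_pack (shift_linear S' (- l1)^*%C).
pose b' := linear_pack (shift_linear P' (- l2)^*%C).
have aa : adjoint_pair a a' by move: (adjoint_pair_shift (- l1) SS'); rewrite shift_opp.
have bb : adjoint_pair b b' by move: (adjoint_pair_shift (- l2) PP'); rewrite shift_opp.
have caa : commute_op a a' by move: (commute_shift (- l1) (- l1)^*%C Sn); rewrite shift_opp.
have cbb : commute_op b b' by move: (commute_shift (- l2) (- l2)^*%C Pn); rewrite shift_opp.
apply: (@approx_null_not_exact R N a b a' b') => //.
apply: approx_null_le gn1 => x /=.
by rewrite addrC lerD2r lerDr.
Qed.

Lemma joint_spectral_point_eigen (T : {linear N -> N}) (l : R[i]) :
    commute_op T S -> commute_op T P -> approx_null (fun x => nrm (T x - l *: x)) ->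
  exists l1 l2 : R[i], [/\ cmod l2 = 1, l1 = l1^*%C * l2, cmod l1 <= 2 &
    approx_null (fun x => nrm (T x - l *: x) + nrm (P x - l2 *: x) + nrm (S x - l1 *: x))].
Proof.
move=> TS TP Tn; have [[Sb Pb] _ _ _] := SPu.
have [||l1 [l2 [/bGammaP[/= ? ? ?] ln]]] :=
   joint_spectral_point (fun=> nrm_ge0 _) _ _ Tn; try exact: stable_under_eigen.
by exists l1, l2.
Qed.

(** No point (l1, 0) belongs to bGamma, so 0 is not an approximate eigenvalue of P. *)
Lemma Gamma_unitary_inverse : exists2 Q : {linear N -> N}, bounded_op Q &
  (forall x, P (Q x) = x) /\ (forall x, Q (P x) = x).
Proof.
have [[Sb Pb] SP [Sn Pn] _] := SPu.
have [P' P'b PP'] := adjoint_exists Pb.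
rewrite /normal_op (adj_unique PP') in Pn.
have [c c0 cP] : exists2 c : R, 0 < c & forall x, c * nrm x <= nrm (P x).
  apply: contrapT => noc.
  have Pn0 : approx_null (fun x => nrm (P x - 0 *: x)).
    move=> e e0; apply: contrapT => noe; apply: noc; exists e => // x.
    rewrite leNgt; apply/negP => Px; apply: noe; exists x.
      by apply: contraTneq Px => ->; rewrite linear0 !nrm0 mulr0 ltxx.
    by rewrite scale0r subr0 ltW.
  have [//|//|l1 [l2 [l2n _ _ ln]]] := joint_spectral_point_eigen _ _ Pn0; last first.
    suff : cmod (0 - l2) <= 0 by rewrite sub0r cmodN l2n ler10.
    apply: (approx_null_bound ln ltr01) => x; rewrite mul1r.
    by apply: le_trans (eigenvalue_gap_le P _ _ _) _; rewrite lerDl nrm_ge0.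
have AL : linear (P' \o P) by exact: linearP.
pose A := linear_pack AL.
have AA : adjoint_pair A A by move=> x y /=; rewrite (adjoint_pairC PP') PP'.
have Asurj : forall y, exists x, A x = y.
  apply: (@coercive_surjective R N A (c ^+ 2) AA) => [|x]; first by rewrite exprn_gt0.
  rewrite /= (adjoint_pairR (adjoint_pairC PP')) rdotxx -exprMn.
  by rewrite ler_pXn2r ?nnegrE ?mulr_ge0 ?nrm_ge0 ?(ltW c0).
have /choice[Q QP] y : exists x, P x = y.
  by have [x xy] := Asurj y; exists (P' x); rewrite Pn.
have Pinj x y : P x = P y -> x = y.
  move=> xy; apply/eqP; rewrite -subr_eq0; apply/eqP/nrm_eq0/eqP.
  rewrite eq_le nrm_ge0 andbT -(pmulr_rle0 _ c0).
  by apply: le_trans (cP _) _; rewrite linearB xy subrr nrm0.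
have Ql : linear Q by move=> a x y; apply: Pinj; rewrite linearP !QP.
exists (linear_pack Ql); last by split=> // x; apply: Pinj; rewrite QP.
apply/bounded_opP; exists c^-1; first by rewrite invr_ge0 ltW.
by move=> x /=; rewrite mulrC ler_pdivlMr // mulrC -[in leRHS](QP x).
Qed.

(** A vector whose norm P increases produces an approximate eigenvalue of P outside the
    unit circle, and so does one whose norm P decreases, through the inverse of P. *)
Lemma Gamma_unitary_isometric x : nrm (P x) = nrm x.
Proof.
have [[Sb Pb] SP [Sn Pn] _] := SPu.
have [P' P'b PP'] := adjoint_exists Pb.
rewrite /normal_op (adj_unique PP') in Pn.
have [->|x0] := eqVneq x 0; first by rewrite linear0.
have nx := nrm_gt0 x0.
have [M M0 PM] := (bounded_opP _).1 Pb.
apply/eqP; rewrite eq_le; apply/andP; split.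
  rewrite leNgt; apply/negP => xP.
  have r0 : 0 < nrm (P x) / nrm x by rewrite divr_gt0 // (lt_trans nx).
  have [|l rl ln] := large_approximate_eigenvalue PP' Pn Pb r0 x0.
    by rewrite divfK ?gt_eqF.
  have [//|//|l1 [l2 [l2n _ _ ln']]] := joint_spectral_point_eigen _ _ ln.
  have : cmod (l - l2) <= 0.
    apply: (approx_null_bound ln' ltr01) => y; rewrite mul1r.
    by apply: le_trans (eigenvalue_gap_le P _ _ _) _; rewrite lerDl nrm_ge0.
  have := cmodD (l - l2) l2; rewrite subrK l2n.
  have : 1 < nrm (P x) / nrm x by rewrite ltr_pdivlMr // mul1r.
  by move: rl; lra.
rewrite leNgt; apply/negP => Px.
have [Q Qb [PQ QP]] := Gamma_unitary_inverse.
have [Q' Q'b QQ'] := adjoint_exists Qb.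
have QS : commute_op Q S by move=> y; rewrite -{1}[y]PQ SP QP.
have QP' : commute_op Q P' by move=> y; rewrite -{1}[y]PQ -Pn QP.
have Qn : commute_op Q Q'.
  have Q'P := commute_adjoint QQ' (adjoint_pairC PP') QP'.
  by move=> y; rewrite -{1}[y]PQ Q'P QP.
have Px0 : P x != 0 by apply: contra_neq x0 => Px0; rewrite -[x]QP Px0 linear0.
have nPx := nrm_gt0 Px0.
have r0 : 0 < nrm x / nrm (P x) by rewrite divr_gt0.
have [|l rl ln] := large_approximate_eigenvalue QQ' Qn Qb r0 Px0.
  by rewrite QP divfK ?gt_eqF.
have [//|y|l1 [l2 [l2n _ _ ln']]] := joint_spectral_point_eigen _ _ ln.
  by rewrite PQ QP.
have : cmod (1 - l * l2) <= 0.
  apply: (approx_null_bound (K := M + cmod l) ln').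
    rewrite ltr_wpDl //; apply: lt_le_trans rl; exact: r0.
  move=> y; rewrite -nrmZ.
  have -> : (1 - l * l2) *: y = P (Q y - l *: y) + l *: (P y - l2 *: y).
    rewrite (linearB P) (linearZ_LR P) /= PQ scalerBr scalerA scalerBl scale1r.
    by rewrite addrA subrK.
  apply: le_trans (nrmD _ _) _; rewrite nrmZ.
  have := PM (Q y - l *: y); have := nrm_ge0 (Q y - l *: y).
  have := nrm_ge0 (P y - l2 *: y); have := nrm_ge0 (S y - l1 *: y).
  move: (nrm (Q y - _)) (nrm (P y - _)) (nrm (S y - _)) => p q s s0 q0 p0.
  have l0 := cmod_ge0 l.
  have := mulr_ge0 M0 q0; have := mulr_ge0 M0 s0.
  have := mulr_ge0 l0 p0; have := mulr_ge0 l0 s0.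
  by rewrite !mulrDl !mulrDr; lra.
have := cmodB 1 (1 - l * l2); rewrite opprB addrC subrK Normc.normcM l2n mulr1.
rewrite Normc.normc1.
have : 1 < nrm x / nrm (P x) by rewrite ltr_pdivlMr // mul1r.
by move: rl; lra.
Qed.

(** Since P is unitary, S commutes with P^* = P^-1, so that D = S - S^* P is normal and
    commutes with S and P. On joint approximate eigenvectors of D, S and P the value of
    D is close to l1 - l1^* l2 = 0, which leaves no room for D <> 0. *)
Lemma Gamma_unitary_symmetric x y : hdot (S x) y = hdot (P x) (S y).
Proof.
have [[Sb Pb] SP [Sn Pn] _] := SPu.
have [S' S'b SS'] := adjoint_exists Sb; have [P' P'b PP'] := adjoint_exists Pb.
rewrite /normal_op (adj_unique SS') in Sn; rewrite /normal_op (adj_unique PP') in Pn.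
have P'P z : P' (P z) = z.
  by apply: dot_inj => w; rewrite -PP' isometric_dot //; exact: Gamma_unitary_isometric.
have PP'K z : P (P' z) = z by rewrite Pn P'P.
have SP' : commute_op S P' by move=> z; rewrite -{1}[S _]P'P -SP PP'K.
have S'P : commute_op S' P := commute_adjoint SS' (adjoint_pairC PP') SP'.
have S'P' : commute_op S' P' := commute_adjoint SS' PP' SP.
have Dl : linear (fun z => S z - S' (P z)).
  by move=> a u v; rewrite !linearP addrACA -scalerDr.
have D'l : linear (fun z => S' z - P' (S z)).
  by move=> a u v; rewrite !linearP addrACA -scalerDr.
pose D := linear_pack Dl; pose D' := linear_pack D'l.
have DD' : adjoint_pair D D'.
  move=> u v; rewrite /= dotBl dotBr SS'; congr (_ - _).
  by rewrite (adjoint_pairC SS') PP'.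
have D'E z : D' z = - P' (D z) by rewrite /= linearB -S'P' P'P opprB.
have DS : commute_op D S by move=> z; rewrite /= linearB -SP -Sn.
have DP : commute_op D P by move=> z; rewrite /= linearB SP S'P.
have DP' : commute_op D P' by move=> z; rewrite /= linearB SP' -S'P' P'P PP'K.
have Dn : commute_op D D' by move=> z; rewrite !D'E linearN DP'.
have Db : bounded_op D.
  have [M M0 SM] := (bounded_opP _).1 Sb; have [L L0 S'L] := (bounded_opP _).1 S'b.
  apply/bounded_opP; exists (M + L); first exact: addr_ge0.
  move=> z; apply: le_trans (nrmB _ _) _; rewrite mulrDl lerD //.
  by rewrite -[in leRHS](Gamma_unitary_isometric z).
(* A nonzero value of D yields an approximate eigenvalue l <> 0 of D. *)
suff D0 : D x = 0.
  have /eqP := D0; rewrite /= subr_eq0 => /eqP ->.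
  by rewrite (adjoint_pairC SS').
apply: contrapT => /eqP Dx.
have x0 : x != 0 by apply: contra_neq Dx => ->; rewrite linear0.
have nD := nrm_gt0 Dx; have nx := nrm_gt0 x0.
have r0 : 0 < nrm (D x) / nrm x by rewrite divr_gt0.
have [|l rl ln] := large_approximate_eigenvalue DD' Dn Db r0 x0.
  by rewrite divfK ?gt_eqF.
have [l1 [l2 [l2n l12 _ ln']]] := joint_spectral_point_eigen DS DP ln.
have [L L0 S'L] := (bounded_opP _).1 S'b.
have S'l := normal_nrm_shift l1 SS' Sn.
have : cmod l <= 0.
  apply: (approx_null_bound (K := 2 + L) ln'); first by rewrite ltr_pwDl.
  move=> z; rewrite -nrmZ.
  have {1}-> : l *: z = (S z - l1 *: z) - S' (P z - l2 *: z) - l2 *: (S' z - l1^*%C *: z)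
      - (D z - l *: z).
    rewrite (linearB S') (linearZ_LR S') /=; apply: dot_injl => w.
    rewrite !(dotBl, dotDl, dotNl, dotZl) {1}l12; ring.
  apply: le_trans (nrmB _ _) _; rewrite !mulrDl.
  apply: le_trans (lerD (nrmB _ _) (lexx _)) _.
  apply: le_trans (lerD (lerD (nrmB _ _) (lexx _)) (lexx _)) _.
  rewrite nrmZ l2n mul1r S'l.
  have := S'L (P z - l2 *: z); have := nrm_ge0 (D z - l *: z).
  have := nrm_ge0 (P z - l2 *: z); have := nrm_ge0 (S z - l1 *: z).
  move: (nrm (D z - _)) (nrm (P z - _)) (nrm (S z - _)) => p q s s0 q0 p0.
  have := mulr_ge0 L0 q0; have := mulr_ge0 L0 s0; have := mulr_ge0 L0 p0.
  by rewrite !mulrDr; lra.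
by move: rl r0; lra.
Qed.

Lemma Gamma_unitary_nrm_le x : nrm (S x) <= 2 * nrm x.
Proof.
have [[Sb Pb] SP [Sn Pn] _] := SPu.
have [S' S'b SS'] := adjoint_exists Sb.
rewrite /normal_op (adj_unique SS') in Sn.
have [->|x0] := eqVneq x 0; first by rewrite linear0 nrm0 mulr0.
have nx := nrm_gt0 x0.
rewrite leNgt; apply/negP => xS.
have r2 : 2 < nrm (S x) / nrm x by rewrite ltr_pdivlMr.
have [|l rl ln] := large_approximate_eigenvalue SS' Sn Sb (lt_trans (ltr0n R 2) r2) x0.
  by rewrite divfK ?gt_eqF.
have [|l1 [l2 [l2n _ l1n ln']]] := joint_spectral_point_eigen _ SP ln; first by [].
have : cmod (l - l1) <= 0.
  apply: (approx_null_bound ln' ltr01) => y; rewrite mul1r.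
  by apply: le_trans (eigenvalue_gap_le S _ _ _) _; rewrite lerD2r lerDl nrm_ge0.
have := cmodD (l - l1) l1; rewrite subrK.
by move: rl; lra.
Qed.

End Gamma_unitary_relations.

(** * Limits of complex sequences *)

Section complex_limits.
Variable R : realType.
Implicit Types (u v : nat -> R[i]) (l m a : R[i]).

Definition tends_to u l := forall e : R, 0 < e ->
  exists N : nat, forall n : nat, (N <= n)%N -> cmod (u n - l) < e.

Lemma cmod_le_ReIm a : cmod a <= `|complex.Re a| + `|complex.Im a|.
Proof.
rewrite -(@ler_pXn2r _ 2) ?nnegrE ?cmod_ge0 ?addr_ge0 // sqr_cmod.
rewrite sqrrD !real_normK ?num_real // addrAC lerDl mulrn_wge0 // mulr_ge0 //.
Qed.

Lemma tends_toP (u : nat -> R[i]) (a b : R) :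
  ((fun n => complex.Re (u n)) @ \oo --> a) ->
  ((fun n => complex.Im (u n)) @ \oo --> b) -> tends_to u (a +i* b)%C.
Proof.
move=> ua ub e e0; have e2 : 0 < e / 2 by rewrite divr_gt0.
have [N _ hN] := proj1 (cvgrPdist_lt _ a) ua _ e2.
have [M _ hM] := proj1 (cvgrPdist_lt _ b) ub _ e2.
exists (maxn N M) => n; rewrite geq_max => /andP[Nn Mn].
apply: le_lt_trans (cmod_le_ReIm _) _.
have := hN n Nn; have := hM n Mn; rewrite /= distrC => hb; rewrite distrC => ha.
rewrite ReD ImD ReN; have -> : complex.Im (- (a +i* b)%C) = - b by [].
by rewrite [e]splitr ltrD.
Qed.

(** If v dominates the increments of a real sequence f, then f + v is decreasing and
    bounded below. *)
Lemma dominated_increments_cvg (u : nat -> R[i]) (v : nat -> R) :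
    (forall n, 0 <= v n) -> (forall n, cmod (u n.+1 - u n) <= v n - v n.+1) ->
  exists l, tends_to u l.
Proof.
move=> v0 uv.
have vdec n : v n.+1 <= v n.
  by rewrite -subr_ge0; apply: le_trans (uv n); exact: cmod_ge0.
have v_cvg : cvgn v.
  apply: nonincreasing_is_cvgn; first exact/nonincreasing_seqP.
  by exists 0 => _ [n _ <-].
suff real_part (f : nat -> R) : (forall n, `|f n.+1 - f n| <= v n - v n.+1) -> cvgn f.
  have [|a ua] := (cvg_ex _).1 (real_part (fun n => complex.Re (u n)) _).
    by move=> n; apply: le_trans (uv n); rewrite -ReN -ReD ler_Re_cmod.
  have [|b ub] := (cvg_ex _).1 (real_part (fun n => complex.Im (u n)) _).
    move=> n; apply: le_trans (uv n); rewrite -!ReMi -ReN -ReD -mulrN -mulrDr.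
    by apply: le_trans (ler_Re_cmod _) _; rewrite Normc.normcM cmodN cmodi mul1r.
  by exists (a +i* b)%C; exact: tends_toP.
move=> fv; rewrite (_ : f = (fun n => (f n + v n) - v n)); last first.
  by apply/funext => n; rewrite addrK.
apply: is_cvgB => //; apply: nonincreasing_is_cvgn.
  apply/nonincreasing_seqP => n; have := fv n; rewrite ler_norml => /andP[_].
  lra.
exists (f 0%N - v 0%N) => _ [n _ <-].
have : f 0%N - v 0%N <= f n - v n.
  elim: n => // n IH; have := fv n; rewrite ler_norml => /andP[]; lra.
have := v0 n; lra.
Qed.

Lemma tends_to_bound u l (M : R) :
  tends_to u l -> (forall n, cmod (u n) <= M) -> cmod l <= M.
Proof.
move=> ul uM; apply/ler_addgt0Pr => e e0; have [N hN] := ul e e0.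
have -> : l = u N - (u N - l) by rewrite opprB addrC subrK.
by apply: le_trans (cmodB _ _) _; rewrite lerD // ltW // hN.
Qed.

Lemma tends_to_unique u l m : tends_to u l -> tends_to u m -> l = m.
Proof.
move=> ul um; apply/eqP; rewrite -subr_eq0; apply/eqP/Normc.eq0_normc/eqP.
rewrite eq_le cmod_ge0 andbT; apply/ler_addgt0Pr => e e0; rewrite add0r.
have e2 : 0 < e / 2 by rewrite divr_gt0.
have [N hN] := ul _ e2; have [M hM] := um _ e2.
have -> : l - m = (u (maxn N M) - m) - (u (maxn N M) - l).
  by rewrite opprB [RHS]addrC addrA subrK.
apply: le_trans (cmodB _ _) _; rewrite [e]splitr ltW // ltrD //.
  by rewrite hM // leq_maxr.
by rewrite hN // leq_maxl.
Qed.

Lemma tends_toD u v l m : tends_to u l -> tends_to v m ->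
  tends_to (fun n => u n + v n) (l + m).
Proof.
move=> ul vm e e0; have e2 : 0 < e / 2 by rewrite divr_gt0.
have [N hN] := ul _ e2; have [M hM] := vm _ e2.
exists (maxn N M) => n; rewrite geq_max => /andP[Nn Mn].
rewrite opprD addrACA; apply: le_lt_trans (cmodD _ _) _.
by rewrite [e]splitr ltrD // ?hN ?hM.
Qed.

Lemma tends_toZ u l a : tends_to u l -> tends_to (fun n => a * u n) (a * l).
Proof.
move=> ul e e0; have a1 : 0 < cmod a + 1 by rewrite ltr_wpDl // cmod_ge0.
have [N hN] := ul _ (divr_gt0 e0 a1); exists N => n Nn.
rewrite -mulrBr Normc.normcM.
have := hN n Nn; rewrite ltr_pdivlMr // mulrDr mulr1 mulrC; apply: le_lt_trans.
by rewrite lerDl cmod_ge0.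
Qed.

Lemma tends_toJ u l : tends_to u l -> tends_to (fun n => (u n)^*%C) l^*%C.
Proof.
move=> ul e e0; have [N hN] := ul e e0; exists N => n Nn.
by rewrite -rmorphB cmodJ hN.
Qed.

Lemma tends_toS u l : tends_to u l -> tends_to (fun n => u n.+1) l.
Proof. by move=> ul e e0; have [N hN] := ul e e0; exists N => n Nn; rewrite hN // leqW. Qed.

Lemma tends_to_cst l : tends_to (fun=> l) l.
Proof. by move=> e e0; exists 0%N => n _; rewrite subrr cmod0. Qed.

Lemma dominated_increments_tend0 (u : nat -> R[i]) (v : nat -> R) :
    (forall n, 0 <= v n) -> (forall n, cmod (u n) <= v n - v n.+1) -> tends_to u 0.
Proof.
move=> v0 uv.
have [|l vl] := @dominated_increments_cvg (fun n => (v n)%:C) v v0.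
  move=> n; rewrite -rmorphB cmodR distrC ger0_norm //.
  by apply: le_trans (uv n); exact: cmod_ge0.
have := tends_toD vl (tends_toZ (-1) (tends_toS vl)); rewrite mulN1r subrr => dv e e0.
have [N hN] := dv e e0; exists N => n Nn; rewrite subr0; apply: le_lt_trans (hN n Nn).
rewrite subr0 mulN1r -rmorphB cmodR; apply: le_trans (uv n) _; exact: ler_norm.
Qed.

End complex_limits.

(** * The operator C attached to a Gamma-isometry *)

Section symbol_of_Gamma_isometry.
Variables (R : realType) (H : hilbertType R) (S P S' P' : {linear H -> H}).
Hypothesis P_iso : forall x, nrm (P x) = nrm x.
Hypothesis SP : commute_op S P.
Hypothesis S_sym : forall x y, hdot (S x) y = hdot (P x) (S y).
Hypothesis S_le2 : forall x, nrm (S x) <= 2 * nrm x.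
Hypothesis SS' : adjoint_pair S S'.
Hypothesis PP' : adjoint_pair P P'.
Implicit Types (x y z : H).

Let PdotP x y : hdot (P x) (P y) = hdot x y. Proof. exact: isometric_dot. Qed.

Let P'P x : P' (P x) = x.
Proof. by apply: dot_inj => w; rewrite -PP' PdotP. Qed.

Let S'P x : S' (P x) = S x.
Proof. by apply: dot_inj => w; rewrite -SS' S_sym SP PdotP. Qed.

Let P'S x : P' (S x) = S' x.
Proof. by apply: dot_inj => w; rewrite -PP' -S_sym SS'. Qed.

Let P'S' : commute_op P' S'.
Proof. exact: commute_adjoint PP' SS' (fun x => esym (SP x)). Qed.

Let S'_le2 x : nrm (S' x) <= 2 * nrm x.
Proof.
apply: nrm_le => [|y]; first by rewrite mulr_ge0 ?nrm_ge0.
rewrite rdotC -(adjoint_pairR SS'); apply: le_trans (ler_norm _) _.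
apply: le_trans (rdot_CS _ _) _; rewrite mulrAC.
by rewrite ler_wpM2r ?nrm_ge0.
Qed.

(** Along the powers of P on the wandering subspace ker P^*, S acts like the Toeplitz
    operator with symbol A + A^* z, A being the compression of S to ker P^*.
    Testing |S| <= 2 on the vectors e + c P e + ... + c^n P^n e, where
    c^* <e, S e> = <S e, e>, gives (2n + 1) |<S e, e>| <= 2 (n + 1) |e|^2. *)
Lemma numerical_range_wandering e : P' e = 0 -> cmod (hdot (S e) e) <= nrm e ^+ 2.
Proof.
move=> P'e; set a := hdot (S e) e.
have [u u1 ua] := rotate_to_real a.
have uJ : u^*%C * u = 1 by rewrite mulrC mulCJ u1 expr1n.
have aE : a = u^*%C * (cmod a)%:C by rewrite -ua mulrA uJ mul1r.
have ca : (u * u)^*%C * a^*%C = a.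
  rewrite {1}aE !conjcM conjc_real conjcK mulrA -[_ * _ * u]mulrA uJ mulr1.
  by rewrite -aE.
have cn : cmod (u * u) = 1 by rewrite Normc.normcM u1 mulr1.
pose w := fix w n := if n is m.+1 then e + (u * u) *: P (w m) else e.
have eP x : hdot e (P x) = 0 by rewrite -(adjoint_pairC PP') P'e dot0l.
have Pe x : hdot (P x) e = 0 by rewrite dotC eP conjc0.
have wn n : nrm (w n) ^+ 2 = n.+1%:R * nrm e ^+ 2.
  elim: n => [|n IH]; first by rewrite mul1r.
  rewrite [w _]/= sqr_nrmD nrmZ cn mul1r P_iso IH /rdot dotZr eP mulr0 mul0rn addr0.
  by rewrite -[n.+2%:R]natr1; ring.
have eSw n : hdot e (S (w n)) = a^*%C.
  case: n => [|n]; first by rewrite -dotC.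
  by rewrite [w _]/= linearD linearZ_LR /= SP dotDr dotZr eP mulr0 addr0 -dotC.
have Sw n : hdot (S (w n)) (w n) = (n.*2.+1)%:R * a.
  elim: n => [|n IH]; first by rewrite mul1r.
  rewrite [w _]/= linearD linearZ_LR /= dotDl !dotDr !dotZl !dotZr.
  rewrite (S_sym e (P _)) !SP PdotP eSw ca Pe mulr0 PdotP IH -/a.
  have -> : (u * u) * ((u * u)^*%C * (n.*2.+1%:R * a)) = n.*2.+1%:R * a.
    by rewrite mulrA mulCJ cn expr1n mul1r.
  by rewrite doubleS -[in RHS]natr1 -[in RHS]natr1; ring.
have bd n : n.*2.+1%:R * cmod a <= 2 * (n.+1%:R * nrm e ^+ 2).
  have := dot_CS (S (w n)) (w n); rewrite Sw Normc.normcM.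
  have -> : cmod n.*2.+1%:R = n.*2.+1%:R :> R.
    by rewrite -(rmorph_nat (real_complex R)) cmodR normr_nat.
  move/le_trans; apply; rewrite -wn expr2 mulrA.
  by rewrite ler_wpM2r ?nrm_ge0.
rewrite leNgt; apply/negP => ea.
have d0 : 0 < cmod a - nrm e ^+ 2 by rewrite subr_gt0.
pose n := Num.truncn (nrm e ^+ 2 / (cmod a - nrm e ^+ 2)).
have := truncnS_gt (nrm e ^+ 2 / (cmod a - nrm e ^+ 2)); rewrite -/n ltr_pdivrMr //.
have := bd n; rewrite -[n.*2.+1%:R]natr1 -[n.+1%:R]natr1 -muln2 natrM.
have : 0 <= n%:R :> R by [].
move=> n0 h1; have := mulr_ge0 n0 (ltW d0).
by lra.
Qed.

Let D x := x - P (P' x).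

Let P'D x : P' (D x) = 0. Proof. by rewrite /D linearB /= P'P subrr. Qed.

Let nrmD2 x : nrm (D x) ^+ 2 = nrm x ^+ 2 - nrm (P' x) ^+ 2.
Proof.
rewrite /D sqr_nrmB P_iso rdotC (adjoint_pairR PP') rdotxx; ring.
Qed.

Let defect_form x y : hdot (S' (D x)) (D y) = hdot (S' x) y - hdot (S (P' x)) y.
Proof.
rewrite /D (linearB S') S'P dotBr -[hdot _ (P _)](adjoint_pairC PP').
by rewrite (linearB P') /= P'S' P'S subrr dot0l subr0 dotBl.
Qed.

(** On the wandering part C must act as the compression of S to ker P^*, copied along
    the powers of P, and on the unitary part as S / 2. With D = 1 - P P^* this leads to
    the operators C_n, the sum over i < n of P^i D S P^*i plus P^n (S / 2) P^*n, of
    which c n is the form (x, y) |-> <x, C_n y>. *)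
Let c (n : nat) x y : R[i] :=
  \sum_(i < n) hdot (S' (D (iter i P' x))) (D (iter i P' y))
  + 2^-1 * hdot (S' (iter n P' x)) (iter n P' y).

Let c_Pl n x y : c n.+1 (P x) y = c n x (P' y).
Proof.
rewrite /c big_ord_recl /= /D P'P subrr linear0 dot0l add0r.
congr (_ + _ * _); last by rewrite -!iterS !iterSr P'P.
by apply: eq_bigr => i _; rewrite -!iterS !iterSr P'P.
Qed.

Let c_Pr n x y : c n.+1 x (P y) = c n (P' x) y.
Proof.
rewrite /c big_ord_recl /= {2}/D P'P subrr dot0r add0r.
congr (_ + _ * _); last by rewrite -!iterS !iterSr P'P.
by apply: eq_bigr => i _; rewrite -!iterS !iterSr P'P.
Qed.

(** These terms of P C_n^* telescope against those of C_(n+1). *)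
Let defect_form_step n x y :
  (hdot (S' (D (iter n P' y))) (D (iter n.+1 P' x)))^*%C =
  hdot (S (iter n.+1 P' x)) (iter n P' y) - hdot (S' (iter n.+1 P' x)) (iter n.+1 P' y).
Proof.
rewrite defect_form rmorphB /= -!dotC SS'.
by rewrite -(adjoint_pairC SS').
Qed.

Let cS n x y : c n.+1 x y = c n x y +
  2^-1 * (hdot (S' (D (iter n P' x))) (D (iter n P' y))
       - (hdot (S' (D (iter n P' y))) (D (iter n.+1 P' x)))^*%C).
Proof.
by rewrite /c big_ord_recr /= defect_form_step defect_form; field.
Qed.

(** P C_n^* is C_(n+1)^* P, so this says that C_(n+1) + C_(n+1)^* P equals S up to a
    term that involves x and y only through D P^*n.+1 x and D P^*n y. *)
Let c_sum n x y : c n.+1 x y + (c n y (P' x))^*%C =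
  hdot x (S y) - 2^-1 * (hdot (S' (D (iter n P' y))) (D (iter n.+1 P' x)))^*%C.
Proof.
elim: n => [|n IH].
  rewrite defect_form_step /c big_ord0 big_ord_recl big_ord0 add0r addr0 /= conjcM -dotC.
  rewrite -(adjoint_pairC SS') defect_form -SS' conjc_inv conjc_nat; by field.
have half : (2^-1)^*%C = 2^-1 :> R[i] by rewrite conjc_inv conjc_nat.
have -> : (c n.+1 y (P' x))^*%C = (c n y (P' x))^*%C
    + 2^-1 * ((hdot (S' (D (iter n P' y))) (D (iter n.+1 P' x)))^*%C
       - hdot (S' (D (iter n.+1 P' x))) (D (iter n.+1 P' y))).
  by rewrite cS rmorphD /= conjcM half rmorphB /= conjcK -!iterS !iterSr.
rewrite (cS n.+1 x y) -[hdot x (S y)](subrK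
  (2^-1 * (hdot (S' (D (iter n P' y))) (D (iter n.+1 P' x)))^*%C)).
by rewrite -IH; field.
Qed.

Let sum_defect n x :
  \sum_(i < n) nrm (D (iter i P' x)) ^+ 2 = nrm x ^+ 2 - nrm (iter n P' x) ^+ 2.
Proof.
elim: n => [|n IH]; first by rewrite big_ord0 subrr.
by rewrite big_ord_recr /= IH nrmD2; ring.
Qed.

Let term_le x y : cmod (hdot (S' x) y) <= nrm x ^+ 2 + nrm y ^+ 2.
Proof.
apply: le_trans (dot_CS _ _) _.
apply: le_trans (ler_wpM2r (nrm_ge0 _) (S'_le2 _)) _.
by have := sqr_ge0 (nrm x - nrm y); rewrite sqrrB; lra.
Qed.

Let half_term_le x y : cmod (2^-1 * hdot (S' x) y) <= 2^-1 * (nrm x ^+ 2 + nrm y ^+ 2).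
Proof.
rewrite Normc.normcM -(rmorph_nat (real_complex R)) -fmorphV cmodR ger0_norm //.
by rewrite ler_pM2l.
Qed.

Let c_le n x y : cmod (c n x y) <= nrm x ^+ 2 + nrm y ^+ 2.
Proof.
apply: le_trans (cmodD _ _) _; apply: le_trans (lerD (lexx _) (half_term_le _ _)) _.
have : cmod (\sum_(i < n) hdot (S' (D (iter i P' x))) (D (iter i P' y))) <=
    (nrm x ^+ 2 - nrm (iter n P' x) ^+ 2) + (nrm y ^+ 2 - nrm (iter n P' y) ^+ 2).
  rewrite -!sum_defect -big_split /=.
  elim/big_ind2: _ => [|a s b t sa tb|i _]; first by rewrite cmod0.
    by apply: le_trans (cmodD _ _) _; exact: lerD.
  exact: term_le.
have := sqr_ge0 (nrm (iter n P' x)); have := sqr_ge0 (nrm (iter n P' y)); lra.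
Qed.

Let c_diag_le n x : cmod (c n x x) <= nrm x ^+ 2.
Proof.
apply: le_trans (cmodD _ _) _; apply: le_trans (lerD (lexx _) (half_term_le _ _)) _.
suff : cmod (\sum_(i < n) hdot (S' (D (iter i P' x))) (D (iter i P' x))) <=
    nrm x ^+ 2 - nrm (iter n P' x) ^+ 2 by lra.
rewrite -sum_defect.
elim/big_ind2: _ => [|a s b t sa tb|i _]; first by rewrite cmod0.
  by apply: le_trans (cmodD _ _) _; exact: lerD.
rewrite (adjoint_pairC SS') dotC cmodJ; apply: numerical_range_wandering; exact: P'D.
Qed.

Let c_cvg x y : exists l, tends_to (fun n => c n x y) l.
Proof.
pose v n := 2^-1 * nrm (iter n P' x) ^+ 2 + nrm (iter n P' y) ^+ 2
   + 2^-1 * nrm (iter n.+1 P' x) ^+ 2.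
apply: (@dominated_increments_cvg R _ v) => n.
  have := sqr_ge0 (nrm (iter n P' x)); have := sqr_ge0 (nrm (iter n P' y)).
  by have := sqr_ge0 (nrm (iter n.+1 P' x)); rewrite /v; lra.
rewrite cS addrAC subrr add0r mulrBr.
apply: le_trans (cmodB _ _) _.
have half (a : R[i]) : cmod (2^-1 * a^*%C) = cmod (2^-1 * a) by rewrite !Normc.normcM cmodJ.
rewrite half; apply: le_trans (lerD (half_term_le _ _) (half_term_le _ _)) _.
by rewrite !nrmD2 /v /=; lra.
Qed.

Let climit x y : R[i] := sval (cid (c_cvg x y)).
Let climitP x y : tends_to (fun n => c n x y) (climit x y).
Proof. by rewrite /climit; case: cid. Qed.

Let Dl a x y : D (a *: x + y) = a *: D x + D y.
Proof. by rewrite /D !linearP addrACA -scalerDr. Qed.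

Let iterP (n : nat) a x y : iter n P' (a *: x + y) = a *: iter n P' x + iter n P' y.
Proof. by elim: n => //= n ->; rewrite linearP. Qed.

Let climit_l a x y z : climit (a *: x + y) z = a * climit x z + climit y z.
Proof.
apply: (tends_to_unique (climitP _ _)).
have -> : (fun n => c n (a *: x + y) z) = (fun n => a * c n x z + c n y z).
  apply/funext => n; rewrite /c iterP linearP dotDl dotZl !mulrDr mulr_sumr.
  have -> : \sum_(i < n) hdot (S' (D (iter i P' (a *: x + y)))) (D (iter i P' z)) =
    \sum_(i < n) a * hdot (S' (D (iter i P' x))) (D (iter i P' z)) +
    \sum_(i < n) hdot (S' (D (iter i P' y))) (D (iter i P' z)).
    by rewrite -big_split; apply: eq_bigr => i _; rewrite iterP Dl linearP dotDl dotZl.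
  by rewrite /=; ring.
by apply: tends_toD; [apply: tends_toZ|]; exact: climitP.
Qed.

Let climit_r a x y z : climit x (a *: y + z) = a^*%C * climit x y + climit x z.
Proof.
apply: (tends_to_unique (climitP _ _)).
have -> : (fun n => c n x (a *: y + z)) = (fun n => a^*%C * c n x y + c n x z).
  apply/funext => n; rewrite /c iterP dotDr dotZr !mulrDr mulr_sumr.
  have -> : \sum_(i < n) hdot (S' (D (iter i P' x))) (D (iter i P' (a *: y + z))) =
    \sum_(i < n) a^*%C * hdot (S' (D (iter i P' x))) (D (iter i P' y)) +
    \sum_(i < n) hdot (S' (D (iter i P' x))) (D (iter i P' z)).
    by rewrite -big_split; apply: eq_bigr => i _; rewrite iterP Dl dotDr dotZr.
  by rewrite /=; ring.
by apply: tends_toD; [apply: tends_toZ|]; exact: climitP.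
Qed.

Let climit_le x y : cmod (climit x y) <= 2 * nrm x * nrm y.
Proof.
have Z0l z : climit 0 z = 0.
  have := climit_l 1 0 0 z; rewrite scale1r addr0 mul1r => /eqP.
  by rewrite -subr_eq0 opprD addNKr oppr_eq0 => /eqP.
have Z0r z : climit z 0 = 0.
  have := climit_r 1 z 0 0; rewrite scale1r addr0 conjc1 mul1r => /eqP.
  by rewrite -subr_eq0 opprD addNKr oppr_eq0 => /eqP.
have [->|x0] := eqVneq x 0; first by rewrite Z0l cmod0 nrm0 mulr0 mul0r.
have [->|y0] := eqVneq y 0; first by rewrite Z0r cmod0 nrm0 mulr0.
have nx := nrm_gt0 x0; have ny := nrm_gt0 y0.
pose ux := (nrm x)^-1%:C *: x; pose uy := (nrm y)^-1%:C *: y.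
have u1 z : 0 < nrm z -> nrm ((nrm z)^-1%:C *: z) = 1.
  by move=> nz; rewrite nrmZR ger0_norm ?invr_ge0 ?(ltW nz) // mulVf // gt_eqF.
have uz z : 0 < nrm z -> (nrm z)%:C *: ((nrm z)^-1%:C *: z) + 0 = z.
  by move=> nz; rewrite addr0 scalerA -rmorphM divff ?scale1r // gt_eqF.
rewrite -{1}(uz x nx) -{1}(uz y ny) climit_l climit_r Z0l Z0r !addr0.
rewrite !Normc.normcM cmodJ !cmodR !gtr0_norm //.
have -> : 2 * nrm x * nrm y = nrm x * (nrm y * 2) by ring.
rewrite !ler_pM2l //.
apply: tends_to_bound (climitP _ _) _ => n.
by apply: le_trans (c_le _ _ _) _; rewrite !u1 // expr1n.
Qed.

(** C is the limit of the forms c n; each of its properties passes to the limit from an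
    exact identity between c n and c (n + 1), or from a bound uniform in n. *)
Lemma symbol_exists : exists C : {linear H -> H},
  [/\ bounded_op C, commute_op C P, commute_op C P',
      forall x, cmod (hdot (C x) x) <= nrm x ^+ 2
    & forall x y, hdot (C x) y + hdot (P x) (C y) = hdot (S x) y].
Proof.
have [C [CM CP]] := form_representation climit_l climit_r (ler0n _ 2) climit_le.
exists C; split.
- by apply/bounded_opP; exists 2.
- move=> y; apply: dot_inj => x; rewrite -CP -(adjoint_pairC PP') -CP.
  apply: (tends_to_unique (tends_toS (climitP _ _))).
  have -> : (fun n => c n.+1 x (P y)) = (fun n => c n (P' x) y).
    by apply/funext => n; rewrite c_Pr.
  exact: climitP.
- move=> y; apply: dot_inj => x; rewrite -CP -PP' -CP; apply/esym.
  apply: (tends_to_unique (tends_toS (climitP _ _))).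
  have -> : (fun n => c n.+1 (P x) y) = (fun n => c n x (P' y)).
    by apply/funext => n; rewrite c_Pl.
  exact: climitP.
- move=> x; rewrite dotC cmodJ -CP; apply: tends_to_bound (climitP _ _) _ => n.
  exact: c_diag_le.
move=> y x.
suff main : climit x y + (climit (P y) x)^*%C = hdot x (S y).
  by rewrite [RHS]dotC -main rmorphD /= conjcK [in RHS]CP -dotC CP.
have l1 := tends_toS (climitP x y).
have l2 := tends_toJ (tends_toS (climitP (P y) x)).
apply: (tends_to_unique (tends_toD l1 l2)).
have -> : (fun n => c n.+1 x y + (c n.+1 (P y) x)^*%C) = (fun n => hdot x (S y)
     + (- 2^-1) * (hdot (S' (D (iter n P' y))) (D (iter n.+1 P' x)))^*%C).
  by apply/funext => n; rewrite c_Pl c_sum mulNr.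
rewrite -[X in tends_to _ X]addr0; apply: tends_toD; first exact: tends_to_cst.
rewrite -(mulr0 (- 2^-1)); apply: tends_toZ.
apply: (@dominated_increments_tend0 _ _
  (fun n => nrm (iter n P' y) ^+ 2 + nrm (iter n.+1 P' x) ^+ 2)) => n.
  by rewrite addr_ge0 ?sqr_ge0.
rewrite cmodJ; apply: le_trans (term_le _ _) _.
by rewrite !nrmD2 /=; lra.
Qed.
End symbol_of_Gamma_isometry.

(** * The unitary extension of an isometry: the complete normed space *)

(** The extension space is a type that depends on the isometry, so the isometry comes
    bundled with the facts that its Hilbert structure needs. *)
Record isometry_pair (R : realType) (H : hilbertType R) := IsometryPair {
  ip_op : {linear H -> H};
  ip_adj : {linear H -> H};
  ip_iso : forall x, nrm (ip_op x) = nrm x;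
  ip_pair : adjoint_pair ip_op ip_adj }.

Section hull.
Variables (R : realType) (H : hilbertType R) (A : isometry_pair H).
Local Notation P := (ip_op A).
Local Notation P' := (ip_adj A).

(** The inverse limit of H along P^*: a vector of the unitary extension is the sequence
    of the projections of its forward shifts to H. *)
Definition coherent (x : nat -> H) : Prop :=
  (forall n, P' (x n.+1) = x n) /\ exists M : R, forall n, nrm (x n) <= M.

Definition coherent_seq : {pred nat -> H} := fun x => `[< coherent x >].

Lemma coherent_submod_closed : submod_closed coherent_seq.
Proof.
split.
  by apply/asboolP; split=> [n|]; [exact: linear0|exists 0 => n; rewrite nrm0].
move=> a x y /asboolP[xP [M xM]] /asboolP[yP [L yL]].
apply/asboolP; split=> [n|].
  rewrite -[LHS]/(P' (a *: x n.+1 + y n.+1)).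
  by rewrite linearP xP yP.
exists (cmod a * M + L) => n; rewrite -[X in nrm X]/(a *: x n + y n).
apply: le_trans (nrmD _ _) _; rewrite nrmZ.
by rewrite lerD // ler_wpM2l // cmod_ge0.
Qed.

HB.instance Definition _ :=
  GRing.isSubmodClosed.Build R[i] (nat -> H) coherent_seq coherent_submod_closed.

Record hull := Hull { hull_seq :> nat -> H; hull_coherent : hull_seq \in coherent_seq }.

HB.instance Definition _ := [isSub for hull_seq].
HB.instance Definition _ := [Choice of hull by <:].
HB.instance Definition _ := [SubChoice_isSubLmodule of hull by <:].
Implicit Types x y z : hull.


Lemma hullD x y n : (x + y) n = x n + y n. Proof. by []. Qed.
Lemma hullN x n : (- x) n = - x n. Proof. by []. Qed.
Lemma hullZ (a : R[i]) x n : (a *: x) n = a *: x n. Proof. by []. Qed.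
Lemma hull_eq x y : (forall n, x n = y n) -> x = y.
Proof. by move=> xy; apply: val_inj; apply/funext => n; exact: xy. Qed.

Lemma hull_adj x n : P' (x n.+1) = x n.
Proof. by have /asboolP[xP _] := hull_coherent x; exact: xP. Qed.

Lemma ip_adjK v : P' (P v) = v.
Proof.
by apply: dot_inj => w; rewrite -(ip_pair A) isometric_dot //; exact: ip_iso.
Qed.

Lemma nrm_ip_adj v : nrm (P' v) <= nrm v.
Proof.
apply: nrm_le => [|w]; first exact: nrm_ge0.
rewrite rdotC -(adjoint_pairR (ip_pair A)); apply: le_trans (ler_norm _) _.
by apply: le_trans (rdot_CS _ _) _; rewrite ip_iso mulrC.
Qed.

Lemma hull_nrm_nondecreasing x : nondecreasing_seq (fun n => nrm (x n)).
Proof. by apply/nondecreasing_seqP => n; rewrite -(hull_adj x n) nrm_ip_adj. Qed.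

Lemma hull_nrm_cvg x : cvgn (fun n => nrm (x n)).
Proof.
apply: nondecreasing_is_cvgn; first exact: hull_nrm_nondecreasing.
have /asboolP[_ [M xM]] := hull_coherent x.
by exists M => _ [n _ <-].
Qed.

Definition hull_nrm x : R := limn (fun n => nrm (x n)).

Lemma nrm_le_hull_nrm x n : nrm (x n) <= hull_nrm x.
Proof. exact: (nondecreasing_cvgn_le (@hull_nrm_nondecreasing x) (@hull_nrm_cvg x)). Qed.

Lemma hull_nrm_le x (M : R) : (forall n, nrm (x n) <= M) -> hull_nrm x <= M.
Proof. by move=> xM; apply: limr_le; [exact: hull_nrm_cvg|exact: nearW]. Qed.

Lemma hull_nrm_ge0 x : 0 <= hull_nrm x.
Proof. by apply: le_trans (nrm_le_hull_nrm x 0%N); exact: nrm_ge0. Qed.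

Lemma hull_nrmD x y : hull_nrm (x + y) <= hull_nrm x + hull_nrm y.
Proof.
apply: hull_nrm_le => n; rewrite hullD; apply: le_trans (nrmD _ _) _.
by rewrite lerD // nrm_le_hull_nrm.
Qed.

Lemma hull_nrmZ (a : R[i]) x : hull_nrm (a *: x) = cmod a * hull_nrm x.
Proof.
apply: cvg_lim => //.
have -> : (fun n => nrm ((a *: x) n)) = cst (cmod a) \* (fun n => nrm (x n)).
  by apply/funext => n; rewrite hullZ nrmZ.
by apply: cvgM; [exact: cvg_cst|exact: hull_nrm_cvg].
Qed.

Lemma hull_nrmN x : hull_nrm (- x) = hull_nrm x.
Proof. by rewrite /hull_nrm; congr (limn _); apply/funext => n; rewrite hullN nrmN. Qed.

Lemma hull_nrm_eq0 x : hull_nrm x = 0 -> x = 0.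
Proof.
move=> x0; apply: hull_eq => n; apply: nrm_eq0; apply/eqP.
by rewrite eq_le nrm_ge0 andbT -x0 nrm_le_hull_nrm.
Qed.

Lemma hull_normD x y : (hull_nrm (x + y))%:C <= (hull_nrm x)%:C + (hull_nrm y)%:C :> R[i].
Proof. by rewrite -rmorphD lecR hull_nrmD. Qed.
Lemma hull_normZ (a : R[i]) x : (hull_nrm (a *: x))%:C = `|a| * (hull_nrm x)%:C.
Proof. by rewrite hull_nrmZ rmorphM. Qed.
Lemma hull_norm_eq0 x : (hull_nrm x)%:C = 0 :> R[i] -> x = 0.
Proof. by move=> /eqP; rewrite eq_complex /= => /andP[/eqP x0 _]; exact: hull_nrm_eq0. Qed.

HB.instance Definition _ :=
  Lmodule_isNormed.Build R[i] hull hull_normD hull_normZ hull_norm_eq0.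

Lemma hull_normE x : `|x| = (hull_nrm x)%:C. Proof. by []. Qed.

(** The norm is the supremum of the norms of the entries, so a Cauchy sequence converges
    uniformly in the entries. *)
Lemma hull_cauchy_converges (u : nat -> hull) :
    (forall e : R, 0 < e -> exists N : nat, forall m n : nat,
      (N <= m)%N -> (N <= n)%N -> hull_nrm (u m - u n) < e) ->
  exists l : hull, forall e : R, 0 < e ->
    exists N : nat, forall n : nat, (N <= n)%N -> hull_nrm (u n - l) <= e.
Proof.
move=> u_cauchy.
have /choice[y yP] (k : nat) : exists l : H, forall e : R, 0 < e ->
    exists N : nat, forall n : nat, (N <= n)%N -> nrm (u n k - l) < e.
  apply: cauchy_nrm_converges => e e0; have [N hN] := u_cauchy e e0.
  exists N => m n Nm Nn; apply: le_lt_trans (hN m n Nm Nn).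
  by rewrite -hullN -hullD nrm_le_hull_nrm.
have dist (e : R) (N : nat) : 0 < e ->
    (forall m n, (N <= m)%N -> (N <= n)%N -> hull_nrm (u m - u n) < e) ->
    forall n k, (N <= n)%N -> nrm (u n k - y k) <= e.
  move=> e0 hN n k Nn; apply/ler_addgt0Pr => d d0.
  have [M hM] := yP k d d0.
  have -> : u n k - y k = (u n k - u (maxn N M) k) + (u (maxn N M) k - y k).
    by rewrite addrA subrK.
  apply: le_trans (nrmD _ _) _; rewrite lerD //; last by rewrite ltW // hM // leq_maxr.
  rewrite -hullN -hullD; apply: le_trans (nrm_le_hull_nrm _ _) _.
  by rewrite ltW // hN // leq_maxl.
have y_coherent : y \in coherent_seq.
  apply/asboolP; split=> [k|].
    apply/eqP; rewrite -subr_eq0; apply/eqP/nrm_eq0/eqP; rewrite eq_le nrm_ge0 andbT.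
    apply/ler_addgt0Pr => e e0; rewrite add0r.
    have e2 : 0 < e / 2 by rewrite divr_gt0.
    have [N hN] := u_cauchy _ e2.
    have -> : P' (y k.+1) - y k = (u N k - y k) - P' (u N k.+1 - y k.+1).
      by rewrite linearB hull_adj opprB [RHS]addrC addrA subrK.
    apply: le_trans (nrmB _ _) _; rewrite [e]splitr lerD //; first exact: (dist _ N).
    by apply: le_trans (nrm_ip_adj _) _; exact: (dist _ N).
  have [N hN] := u_cauchy _ ltr01; exists (hull_nrm (u N) + 1) => k.
  have -> : y k = u N k - (u N k - y k) by rewrite opprB addrC subrK.
  apply: le_trans (nrmB _ _) _; rewrite lerD ?nrm_le_hull_nrm //.
  exact: (dist _ N).
exists (Hull y_coherent) => e e0; have [N hN] := u_cauchy e e0.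
by exists N => n Nn; apply: hull_nrm_le => k; rewrite hullD hullN; exact: (dist _ N).
Qed.

Lemma hull_complete (F : set_system hull) : ProperFilter F -> cauchy F -> cvg F.
Proof.
move=> FF /cauchyP Fc.
have inv_gt0 (n : nat) : 0 < n.+1%:R^-1 :> R by rewrite invr_gt0.
have /choice[u uP] (n : nat) : exists x : hull, F (ball x (n.+1%:R^-1)%:C).
  by apply: Fc; rewrite ltcR.
have ball_nrm x (e : R) y : ball x e%:C y = (hull_nrm (x - y) < e).
  by rewrite -ball_normE /= hull_normE ltcR.
have [|l ul] := @hull_cauchy_converges u.
  move=> e e0; have [N hN] := exists_inv_lt (divr_gt0 e0 (ltr0n R 2)).
  exists N => m n Nm Nn.
  have [z []] := filter_ex (filterI (uP m) (uP n)); rewrite !ball_nrm => zm zn.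
  have -> : u m - u n = (u m - z) - (u n - z) by rewrite opprB addrA subrK.
  apply: le_lt_trans (hull_nrmD _ _) _.
  rewrite hull_nrmN.
  have := hN m Nm; have := hN n Nn.
  by move: zm zn; move: (m.+1%:R^-1) (n.+1%:R^-1) => p q; lra.
apply/cvg_ex; exists l; apply/cvg_ballP => e e0.
have eE : e = (complex.Re e)%:C by rewrite RRe_real // gtr0_real.
have e0' : 0 < complex.Re e by rewrite -ltcR -eE.
rewrite eE; have e2 := divr_gt0 e0' (ltr0n R 2).
have [N hN] := exists_inv_lt e2; have [M hM] := ul _ e2.
pose n := maxn N M.
apply: filterS (uP n) => z; rewrite !ball_nrm => zn.
have -> : l - z = (u n - z) - (u n - l) by rewrite opprB [RHS]addrC addrA subrK.
apply: le_lt_trans (hull_nrmD _ _) _.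
rewrite hull_nrmN.
have := hN n (leq_maxl _ _); have := hM n (leq_maxr _ _).
by move: zn; move: (n.+1%:R^-1) => p; lra.
Qed.

HB.instance Definition _ := Uniform_isComplete.Build hull hull_complete.

End hull.

(** * The unitary extension of an isometry: the inner product *)

Section hull_inner_product.
Variables (R : realType) (H : hilbertType R) (A : isometry_pair H).
Local Notation P := (ip_op A).
Local Notation P' := (ip_adj A).
Local Notation hull := (hull A).
Implicit Types (x y z : hull) (v w : H).

Let defect v := v - P (P' v).

Let defect_dot v w : hdot (defect v) (defect w) = hdot v w - hdot (P' v) (P' w).
Proof.
rewrite /defect dotBr -[hdot _ (P _)](adjoint_pairC (ip_pair A)).
by rewrite (linearB P') /= ip_adjK subrr dot0l subr0 dotBl (ip_pair A).
Qed.

Let defect_nrm v : nrm (defect v) ^+ 2 = nrm v ^+ 2 - nrm (P' v) ^+ 2.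
Proof. by apply: complexI; rewrite rmorphB /= -!dotxx defect_dot. Qed.

(** The increments <x (n+1), y (n+1)> - <x n, y n> are inner products of the components
    orthogonal to the range of P, whose squared norms telescope. *)
Lemma hull_dot_cvg x y : exists l, tends_to (fun n => hdot (x n) (y n)) l.
Proof.
pose s z n := 2^-1 * (hull_nrm z ^+ 2 - nrm (z n) ^+ 2).
have s0 z n : 0 <= s z n.
  rewrite mulr_ge0 // subr_ge0 ler_pXn2r ?nnegrE ?nrm_ge0 ?hull_nrm_ge0 //.
  exact: nrm_le_hull_nrm.
apply: (@dominated_increments_cvg R _ (fun n => s x n + s y n)) => n.
  by rewrite addr_ge0.
have -> : hdot (x n.+1) (y n.+1) - hdot (x n) (y n) =
    hdot (defect (x n.+1)) (defect (y n.+1)).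
  by rewrite defect_dot !hull_adj.
apply: le_trans (dot_CS _ _) _.
have := sqr_ge0 (nrm (defect (x n.+1)) - nrm (defect (y n.+1))).
by rewrite sqrrB !defect_nrm !hull_adj /s; lra.
Qed.

Definition hull_dot x y : R[i] := sval (cid (hull_dot_cvg x y)).

Lemma hull_dotP x y : tends_to (fun n => hdot (x n) (y n)) (hull_dot x y).
Proof. by rewrite /hull_dot; case: cid. Qed.

Lemma hull_dotPl (a : R[i]) x y z :
  hull_dot (a *: x + y) z = a * hull_dot x z + hull_dot y z.
Proof.
apply: (tends_to_unique (hull_dotP _ _)).
have -> : (fun n => hdot ((a *: x + y) n) (z n)) =
    (fun n => a * hdot (x n) (z n) + hdot (y n) (z n)).
  by apply/funext => n; rewrite hullD hullZ dotDl dotZl.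
by apply: tends_toD; [apply: tends_toZ|]; exact: hull_dotP.
Qed.

Lemma hull_dotC x y : hull_dot x y = (hull_dot y x)^*%C.
Proof.
apply: (tends_to_unique (hull_dotP _ _)).
have -> : (fun n => hdot (x n) (y n)) = (fun n => (hdot (y n) (x n))^*%C).
  by apply/funext => n; rewrite dotC.
exact/tends_toJ/hull_dotP.
Qed.

Lemma hull_dotxx x : hull_dot x x = (hull_nrm x ^+ 2)%:C.
Proof.
apply: (tends_to_unique (hull_dotP _ _)); apply: tends_toP.
  have -> : (fun n => complex.Re (hdot (x n) (x n))) =
      (fun n => nrm (x n)) \* (fun n => nrm (x n)).
    by apply/funext => n; rewrite dotxx.
  by rewrite expr2; apply: cvgM; exact: hull_nrm_cvg.
have -> : (fun n => complex.Im (hdot (x n) (x n))) = cst 0.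
  by apply/funext => n; rewrite dotxx.
exact: cvg_cst.
Qed.

Lemma hull_dot_bilinear : bilinear_for
  (GRing.Scale.Law.clone _ _ *%R _)
  (GRing.Scale.Law.clone _ _ (Num.conj \; *%R) _) hull_dot.
Proof.
split=> [y a x z|x a y z]; first exact: hull_dotPl.
by rewrite hull_dotC hull_dotPl rmorphD /= conjcM -!hull_dotC.
Qed.

HB.instance Definition _ :=
  bilinear_isBilinear.Build R[i] hull hull R[i] _ _ hull_dot hull_dot_bilinear.

Lemma hull_dot_hermitian x y : hull_dot x y = (-1) ^+ false * Num.conj (hull_dot y x).
Proof. by rewrite expr0 mul1r hull_dotC. Qed.

HB.instance Definition _ :=
  isHermitianSesquilinear.Build R[i] hull false Num.conj hull_dot hull_dot_hermitian.

Lemma hull_dot_gt0 x : x != 0 -> 0 < hull_dot x x.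
Proof.
move=> x0; rewrite hull_dotxx ltcR exprn_gt0 // lt_def hull_nrm_ge0 andbT.
by apply: contra_neq x0; exact: hull_nrm_eq0.
Qed.

HB.instance Definition _ := isDotProduct.Build R[i] hull hull_dot hull_dot_gt0.

Lemma hull_norm_dot x : `|x| ^+ 2 = hull_dot x x.
Proof. by rewrite hull_dotxx hull_normE rmorphXn. Qed.

HB.instance Definition _ := CompleteNormedModule_isHilbert.Build R hull hull_norm_dot.

Lemma hull_hdotE x y : hdot x y = hull_dot x y. Proof. by []. Qed.
Lemma hull_nrmE x : nrm x = hull_nrm x. Proof. by []. Qed.

End hull_inner_product.

(** * A criterion for Gamma-unitaries *)

Section Gamma_unitary_criterion.
Variables (R : realType) (N : hilbertType R) (C C' U U' S : {linear N -> N}).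
Hypothesis CC' : adjoint_pair C C'.
Hypothesis UU' : adjoint_pair U U'.
Hypothesis UK : forall x, U (U' x) = x.
Hypothesis U'K : forall x, U' (U x) = x.
Hypothesis CU : commute_op C U.
Hypothesis Cb : bounded_op C.
Hypothesis Cnr : forall x, cmod (hdot (C x) x) <= nrm x ^+ 2.
Hypothesis SE : forall x, S x = C x + C' (U x).
Implicit Types (x y : N).

Let Uiso x : nrm (U x) = nrm x.
Proof.
by apply/eqP; rewrite -(@eqrXn2 _ 2) ?nrm_ge0 // -!rdotxx (adjoint_pairR UU') U'K.
Qed.

Let CU' : commute_op C U'. Proof. by move=> x; rewrite -{2}[x]UK CU U'K. Qed.
Let C'U : commute_op C' U. Proof. exact: commute_adjoint CC' (adjoint_pairC UU') CU'. Qed.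
Let C'U' : commute_op C' U'. Proof. exact: commute_adjoint CC' UU' CU. Qed.
Let SU : commute_op S U. Proof. by move=> x; rewrite !SE linearD CU C'U. Qed.
Let SU' : commute_op S U'. Proof. by move=> x; rewrite !SE linearD CU' UK -C'U' U'K. Qed.
Let SS' : adjoint_pair S (U' \o S).
Proof.
move=> x y; rewrite /= -UU' !SE dotDl dotDr addrC; congr (_ + _).
  by rewrite (adjoint_pairC CC').
by rewrite -CC' CU UU' U'K.
Qed.

(** Outside bGamma, |l2| - 1 <> 0 or l1 - l1^* l2 <> 0 or |l1| - 2 > 0, and each of these
    defects, times |x|, is estimated by a multiple of |(S - l1) x| + |(U - l2) x|: the
    first as U is isometric, the second by S = S^* U, the third by
    <S x, x> = <C x, x> + <U x, C x>, in which U x is close to l2 x and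
    |<C x, x>| <= |x|^2. *)
Lemma Gamma_unitary_intro : Gamma_unitary S U.
Proof.
have [M M0 CM] := (bounded_opP _).1 Cb.
have [C'' C''b CC''] := adjoint_exists Cb.
have [L L0 C'L] : exists2 L : R, 0 <= L & forall x, nrm (C' x) <= L * nrm x.
  have -> : (C' : N -> N) = C'' by rewrite -(adj_unique CC') (adj_unique CC'').
  exact/bounded_opP.
have Sb : bounded_op S.
  apply/bounded_opP; exists (M + L); first exact: addr_ge0.
  move=> x; rewrite SE; apply: le_trans (nrmD _ _) _; rewrite mulrDl lerD //.
  by rewrite -[in leRHS](Uiso x).
have Ub : bounded_op U by apply/bounded_opP; exists 1 => // x; rewrite mul1r Uiso.
pose S' := linear_pack (linearP (U' \o S)).
have SS'c : commute_op S S' by move=> x /=; rewrite SU'.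
have S'U x : S' (U x) = S x by rewrite /= SU U'K.
have [K K0 SK] := (bounded_opP _).1 Sb.
have S'K x : nrm (S' x) <= K * nrm x.
  by rewrite -(normal_nrm (SS' : adjoint_pair S S') SS'c).
split=> //.
- by split; [rewrite /normal_op (adj_unique SS')|
    rewrite /normal_op (adj_unique UU') => x; rewrite UK U'K].
move=> [l1 l2]; apply: contra_notP => l_notin /=.
pose a := linear_pack (shiftN_linear S l1); pose b := linear_pack (shiftN_linear U l2).
pose a' := linear_pack (shift_linear S' (- l1)^*%C).
pose b' := linear_pack (shift_linear U' (- l2)^*%C).
have aa : adjoint_pair a a'.
  by move: (adjoint_pair_shift (- l1) (SS' : adjoint_pair S S')); rewrite shift_opp.
have bb : adjoint_pair b b' by move: (adjoint_pair_shift (- l2) UU'); rewrite shift_opp.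
have caa : commute_op a a'.
  by move: (commute_shift (- l1) (- l1)^*%C SS'c); rewrite shift_opp.
have Un : commute_op U U' by move=> x; rewrite UK U'K.
have cbb : commute_op b b' by move: (commute_shift (- l2) (- l2)^*%C Un); rewrite shift_opp.
have cab' : commute_op a b'.
  by move: (commute_shift (- l1) (- l2)^*%C SU'); rewrite shift_opp.
have cab : commute_op a b by move: (commute_shift (- l1) (- l2) SU); rewrite !shift_opp.
have exact_of (k p : R) : 0 < k -> 0 <= p ->
    (forall x, k * nrm x <= p * (nrm (a x) + nrm (b x))) -> koszul_exact a b.
  move=> k0 p0 kP; have p1 : 0 < p + 1 by rewrite ltr_wpDl.
  apply: (bounded_below_koszul_exact (d := k / (p + 1)) aa bb) => //; first exact: divr_gt0.
  move=> x; rewrite mulrAC ler_pdivrMr // mulrC mulrC; apply: le_trans (kP x) _.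
  by rewrite mulrC ler_wpM2l ?addr_ge0 ?nrm_ge0 // lerDl.
have [l2n|l2n] := eqVneq (cmod l2) 1; last first.
  apply: (exact_of `|cmod l2 - 1| 1) => // [|x]; first by rewrite normr_gt0 subr_eq0.
  rewrite mul1r; apply: (@le_trans _ _ (nrm (b x))); last by rewrite lerDr nrm_ge0.
  rewrite /= -{1}(ger0_norm (nrm_ge0 x)) -normrM mulrBl mul1r -nrmZ -(Uiso x).
  rewrite ler_norml lerNl opprB; apply/andP; split.
    have := nrmD (U x - l2 *: x) (l2 *: x); rewrite subrK; lra.
  have := nrmB (U x) (U x - l2 *: x); rewrite opprB addrC subrK; lra.
have [l12|l12] := eqVneq l1 (l1^*%C * l2); last first.
  apply: (exact_of (cmod (l1 - l1^*%C * l2)) (K + 2)).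
  - by rewrite cmod_gt0 // subr_eq0.
  - by rewrite addr_ge0.
  move=> x; rewrite -nrmZ.
  have -> : (l1 - l1^*%C * l2) *: x = S' (b x) + l2 *: a' x - a x.
    have -> : S' (b x) = S x - l2 *: S' x.
      by rewrite -[b x]/(U x - l2 *: x) (linearB S') (linearZ_LR S') S'U.
    have -> : a' x = S' x - l1^*%C *: x.
      by rewrite -[LHS]/(S' x + (- l1)^*%C *: x) rmorphN scaleNr.
    rewrite -[a x]/(S x - l1 *: x); apply: dot_injl => z.
    rewrite !(dotBl, dotDl, dotNl, dotZl); ring.
  apply: le_trans (nrmB _ _) _; apply: le_trans (lerD (nrmD _ _) (lexx _)) _.
  rewrite nrmZ l2n mul1r -(normal_nrm aa caa).
  have := S'K (b x); have := nrm_ge0 (a x); have := nrm_ge0 (b x).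
  move=> b0 a0; have := mulr_ge0 K0 a0; rewrite mulrDl mulrDr mulrDr; lra.
have l1n : 2 < cmod l1.
  rewrite ltNge; apply/negP => l1n; apply: l_notin; exact: bGamma_intro.
apply: (exact_of (cmod l1 - 2) (M + 1)).
- by rewrite subr_gt0.
- by rewrite addr_ge0.
move=> x; have [->|x0] := eqVneq x 0; first by rewrite !linear0 nrm0 addr0 !mulr0.
rewrite -(ler_pM2r (nrm_gt0 x0)) mulrBl mulrBl.
have -> : cmod l1 * nrm x * nrm x = cmod (l1 * hdot x x).
  by rewrite dotxx Normc.normcM cmodR ger0_norm ?sqr_ge0 // expr2 mulrA.
have -> : l1 * hdot x x =
    hdot (C x) x + l2 * hdot x (C x) + hdot (b x) (C x) - hdot (a x) x.
  rewrite /= !dotBl !dotZl SE dotDl (adjoint_pairC CC'); ring.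
rewrite lerBlDr; apply: le_trans (cmodB _ _) _.
apply: le_trans (lerD (cmodD _ _) (lexx _)) _.
apply: le_trans (lerD (lerD (cmodD _ _) (lexx _)) (lexx _)) _.
rewrite Normc.normcM l2n mul1r [hdot x (C x)]dotC cmodJ.
have := Cnr x; have := dot_CS (b x) (C x); have := dot_CS (a x) x.
have := ler_wpM2l (nrm_ge0 (b x)) (CM x).
have := mulr_ge0 (mulr_ge0 M0 (nrm_ge0 (a x))) (nrm_ge0 x).
have := mulr_ge0 (nrm_ge0 (b x)) (nrm_ge0 x).
have -> : nrm x ^+ 2 = nrm x * nrm x by rewrite expr2.
rewrite !mulrDl !mulrDr !mulrDl !mul1r.
have -> : nrm (b x) * (M * nrm x) = M * nrm (b x) * nrm x by ring.
lra.
Qed.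
End Gamma_unitary_criterion.

(** * The unitary extension of an isometry: operators and separability *)

Section hull_operators.
Variables (R : realType) (H : hilbertType R) (A : isometry_pair H).
Local Notation P := (ip_op A).
Local Notation P' := (ip_adj A).
Local Notation hull := (hull A).
Implicit Types (x y z : hull) (v w : H) (T : {linear H -> H}).

Lemma hull_op_exists T : bounded_op T -> commute_op T P' ->
  exists2 T1 : {linear hull -> hull}, bounded_op T1 & forall x n, T1 x n = T (x n).
Proof.
move=> /bounded_opP[M M0 TM] TP'.
have /choice[f fE] x : exists y : hull, forall n, y n = T (x n).
  have co : (fun n => T (x n)) \in coherent_seq A.
    apply/asboolP; split=> [n|]; first by rewrite -TP' hull_adj.
    exists (M * hull_nrm x) => n; apply: le_trans (TM _) _.
    by rewrite ler_wpM2l // nrm_le_hull_nrm.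
  by exists (Hull co).
have fl : linear f.
  by move=> a x y; apply: hull_eq => n; rewrite hullD hullZ !fE hullD hullZ linearP.
exists (linear_pack fl) => //; apply/bounded_opP; exists M => // x.
rewrite !hull_nrmE; apply: hull_nrm_le => n; rewrite /= fE; apply: le_trans (TM _) _.
by rewrite ler_wpM2l // nrm_le_hull_nrm.
Qed.

Lemma hull_adjoint_pair T T' (T1 T1' : hull -> hull) : adjoint_pair T T' ->
    (forall x n, T1 x n = T (x n)) -> (forall x n, T1' x n = T' (x n)) ->
  adjoint_pair T1 T1'.
Proof.
move=> TT T1E T1E' x y; rewrite !hull_hdotE; apply: (tends_to_unique (hull_dotP _ _)).
have -> : (fun n => hdot (T1 x n) (y n)) = (fun n => hdot (x n) (T1' y n)).
  by apply/funext => n; rewrite T1E T1E' TT.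
exact: hull_dotP.
Qed.

Lemma shift_coherent x : (fun n => x n.+1) \in coherent_seq A.
Proof.
apply/asboolP; split=> [n|]; first by rewrite hull_adj.
by exists (hull_nrm x) => n; exact: nrm_le_hull_nrm.
Qed.

Lemma unshift_coherent x :
  (fun n => if n is m.+1 then x m else P' (x 0%N)) \in coherent_seq A.
Proof.
apply/asboolP; split=> [[|n]|] //; first by rewrite hull_adj.
exists (hull_nrm x) => -[|n]; last exact: nrm_le_hull_nrm.
by apply: le_trans (nrm_ip_adj _ _) _; exact: nrm_le_hull_nrm.
Qed.

Lemma orbit_coherent v : (fun n => iter n P v) \in coherent_seq A.
Proof.
apply/asboolP; split=> [n|]; first by rewrite /= ip_adjK.
by exists (nrm v) => n; elim: n => //= n IH; rewrite ip_iso.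
Qed.

Lemma shift_is_linear : linear (fun x => Hull (shift_coherent x)).
Proof. by move=> a x y; apply: hull_eq. Qed.

Lemma unshift_is_linear : linear (fun x => Hull (unshift_coherent x)).
Proof. by move=> a x y; apply: hull_eq => -[|n] //=; rewrite linearP. Qed.

Lemma orbit_is_linear : linear (fun v => Hull (orbit_coherent v)).
Proof.
move=> a v w; apply: hull_eq => n; rewrite hullD hullZ /=.
by elim: n => //= n ->; rewrite linearP.
Qed.

Definition hull_shift := linear_pack shift_is_linear.
Definition hull_unshift := linear_pack unshift_is_linear.
Definition hull_embed := linear_pack orbit_is_linear.

Lemma hull_shiftE x n : hull_shift x n = x n.+1. Proof. by []. Qed.
Lemma hull_embedE v n : hull_embed v n = iter n P v. Proof. by []. Qed.

Lemma hull_unshiftK x : hull_shift (hull_unshift x) = x.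
Proof. exact: hull_eq. Qed.

Lemma hull_shiftK x : hull_unshift (hull_shift x) = x.
Proof. by apply: hull_eq => -[|n] //; exact: hull_adj. Qed.

Lemma hull_shift_adjoint : adjoint_pair hull_shift hull_unshift.
Proof.
move=> x y; rewrite !hull_hdotE; apply: (tends_to_unique (hull_dotP _ _)).
have -> : (fun n => hdot (hull_shift x n) (y n)) =
  (fun n => hdot (x n.+1) (hull_unshift y n.+1)) by [].
exact/(tends_toS (u := fun n => hdot (x n) (hull_unshift y n)))/hull_dotP.
Qed.

Lemma hull_embed_dot v w : hdot (hull_embed v) (hull_embed w) = hdot v w.
Proof.
rewrite hull_hdotE; apply: (tends_to_unique (hull_dotP _ _)).
have -> : (fun n => hdot (hull_embed v n) (hull_embed w n)) = (fun=> hdot v w).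
  apply/funext => n; rewrite !hull_embedE; elim: n => //= n IH.
  by rewrite isometric_dot //; exact: ip_iso.
exact: tends_to_cst.
Qed.

Lemma hull_embed_shift v : hull_shift (hull_embed v) = hull_embed (P v).
Proof. by apply: hull_eq => n; rewrite hull_shiftE !hull_embedE -iterSr. Qed.

Let nrm_unshift x : nrm (hull_unshift x) = nrm x.
Proof.
apply/eqP; rewrite -(@eqrXn2 _ 2) ?nrm_ge0 // -!rdotxx.
by rewrite (adjoint_pairR (adjoint_pairC hull_shift_adjoint)) hull_unshiftK.
Qed.

(** The backward shifts of the embedded copy of H exhaust the hull: the k-fold backward
    shift of the orbit of x k lies at squared distance lim |x n|^2 - |x k|^2 from x. *)
Lemma hull_separable : separable_space H -> separable_space hull.
Proof.
case=> D Dc Dd.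
pose E := \bigcup_(k in [set: nat]) [set iter k hull_unshift (hull_embed v) | v in D].
exists E.
  apply: bigcup_countable => // k _.
  exact: sub_countable (card_image_le _ _) Dc.
move=> O [x Ox] Oopen.
have [e0 /= e0_gt0 ballO] : nbhs_ball x O by rewrite nbhs_ballE; exact: open_nbhs_nbhs.
have eE : e0 = (complex.Re e0)%:C by rewrite RRe_real // gtr0_real.
set e := complex.Re e0 in eE; have e_gt0 : 0 < e by rewrite -ltcR -eE.
have e2 : 0 < e / 2 by rewrite divr_gt0.
have ballE y : ball x e0 y = (nrm (x - y) < e).
  by rewrite -ball_normE /= normE eE ltcR.
have [k kP] : exists k, hull_nrm x ^+ 2 - nrm (x k) ^+ 2 <= (e / 2) ^+ 2.
  have X1 : 0 < hull_nrm x *+ 2 + 1 by rewrite ltr_wpDl // mulrn_wge0 // hull_nrm_ge0.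
  have d0 : 0 < (e / 2) ^+ 2 / (hull_nrm x *+ 2 + 1) by rewrite divr_gt0 // exprn_gt0.
  have [k _ /(_ k (leqnn k)) /= hk] :=
    proj1 (cvgrPdist_lt _ _) (@hull_nrm_cvg _ _ _ x) _ d0.
  exists k; have xk := nrm_le_hull_nrm x k.
  have := hk; rewrite -/(hull_nrm x) ger0_norm ?subr_ge0 // ltr_pdivlMr // => /ltW.
  apply: le_trans.
  rewrite subr_sqr ler_wpM2l ?subr_ge0 //.
  by have := nrm_ge0 (x k); lra.
have [v [Dv vk]] : exists v, D v /\ nrm (x k - v) < e / 2.
  have [|v [/= vb Dv]] := Dd (ball (x k) (e / 2)%:C) _ (ball_open _ _).
    by exists (x k); apply: ballxx; rewrite ltcR.
  by exists v; split => //; move: vb; rewrite -ball_normE /= normE ltcR.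
exists (iter k hull_unshift (hull_embed v)); split; last by exists k => //; exists v.
apply: ballO; rewrite ballE.
have iter_nrm y : nrm (iter k hull_unshift y) = nrm y.
  by elim: (k) => // j IH; rewrite iterS nrm_unshift.
have iterB y z :
    iter k hull_unshift (y - z) = iter k hull_unshift y - iter k hull_unshift z.
  by elim: (k) => // j IH; rewrite !iterS IH linearB.
have iterK : iter k hull_unshift (iter k hull_shift x) = x.
  by elim: (k) => // j IH; rewrite iterSr iterS hull_shiftK.
have iter_shiftE n : iter k hull_shift x n = x (n + k)%N.
  elim: (k) n => [|j IH] n; first by rewrite addn0.
  by rewrite iterS hull_shiftE IH addnS addSn.
have -> : x - iter k hull_unshift (hull_embed v) =
    iter k hull_unshift ((iter k hull_shift x - hull_embed (x k)) + hull_embed (x k - v)).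
  by rewrite linearB addrA subrK iterB iterK.
rewrite iter_nrm; apply: le_lt_trans (nrmD _ _) _; rewrite [e]splitr ler_ltD //; last first.
  suff -> : nrm (hull_embed (x k - v)) = nrm (x k - v) by [].
  by apply/eqP; rewrite -(@eqrXn2 _ 2) ?nrm_ge0 // -!rdotxx /rdot hull_embed_dot.
rewrite hull_nrmE; apply: hull_nrm_le => n.
rewrite -(@ler_pXn2r _ 2) ?nnegrE ?nrm_ge0 ?(ltW e2) //; apply: le_trans kP.
rewrite hullD hullN iter_shiftE sqr_nrmB.
have -> : nrm (hull_embed (x k) n) = nrm (x k).
  by rewrite hull_embedE; elim: (n) => //= m IH; rewrite ip_iso.
have -> : rdot (x (n + k)%N) (hull_embed (x k) n) = nrm (x k) ^+ 2.
  rewrite hull_embedE; elim: (n) => [|m IH] /=; first by rewrite rdotxx.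
  by rewrite rdotC (adjoint_pairR (ip_pair A)) hull_adj rdotC.
have : nrm (x (n + k)%N) ^+ 2 <= hull_nrm x ^+ 2.
  by rewrite ler_pXn2r ?nnegrE ?nrm_ge0 ?hull_nrm_ge0 // nrm_le_hull_nrm.
lra.
Qed.
End hull_operators.

(** * The characterization of Gamma-isometries *)

Section numerical_radius_bound.
Variables (R : realType) (H : hilbertType R) (C : {linear H -> H}).
Hypothesis Cb : bounded_op C.

Lemma numerical_radius_le1 :
  numerical_radius C <= 1 <-> forall x, cmod (hdot (C x) x) <= nrm x ^+ 2.
Proof.
split=> [C1 x|C1].
  have [->|x0] := eqVneq x 0; first by rewrite dot0r cmod0 sqr_ge0.
  have nx := nrm_gt0 x0.
  pose u := (nrm x)^-1%:C *: x.
  have un : nrm u = 1 by rewrite nrmZR ger0_norm ?invr_ge0 ?(ltW nx) // mulVf // gt_eqF.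
  have [M M0 CM] := (bounded_opP _).1 Cb.
  have Cu : cmod (hdot (C u) u) <= 1.
    apply: le_trans C1; apply: sup_upper_bound; last by exists u; rewrite //= normE un.
    split; first by exists (cmod (hdot (C u) u)), u; rewrite //= normE un.
    exists M => t [y /=]; rewrite normE lecR => y1 <-.
    apply: le_trans (dot_CS _ _) _.
    apply: le_trans (ler_pM (nrm_ge0 _) (nrm_ge0 _) (CM y) y1) _.
    by rewrite mulr1 ler_piMr.
  have xu : x = (nrm x)%:C *: u by rewrite scalerA -rmorphM divff ?scale1r // gt_eqF.
  rewrite {1 2}xu (linearZ_LR C) dotZl dotZr conjc_real !Normc.normcM cmodR.
  rewrite ger0_norm ?nrm_ge0 //.
  by rewrite mulrA -expr2 ler_piMr // sqr_ge0.
apply: ge_sup; first by exists (cmod (hdot (C 0) 0)), 0; rewrite //= normr0.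
move=> t [x /= x1 <-]; apply: le_trans (C1 x) _.
by rewrite expr_le1 ?nrm_ge0 // -lecR -normE.
Qed.

End numerical_radius_bound.

Theorem theorem2p18 (R : realType) (H : hilbertType R) (S P : {linear H -> H})
    (Hsep : separable_space H) (HS : bounded_op S) (HP : bounded_op P) :
  Gamma_isometry S P <->
  isometric P /\
  exists C : {linear H -> H},
    [/\ bounded_op C,
        commute_op C P,
        commute_op C (adj P),
        numerical_radius C <= 1
      & forall x, S x = C x + adj C (P x)].
Proof.
have [P' P'b PP'] := adjoint_exists HP; rewrite (adj_unique PP').
split=> [[SP [N [V [S1 [P1 [_ Vdot SPu VS VP]]]]]]|[Piso [C [Cb CP CP' C1 SE]]]].
  have Vnrm x : nrm (V x) = nrm x.
    by apply/eqP; rewrite -(@eqrXn2 _ 2) ?nrm_ge0 // -!rdotxx /rdot Vdot.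
  have Piso x : nrm (P x) = nrm x.
    by rewrite -Vnrm -VP (Gamma_unitary_isometric SPu) Vnrm.
  have Ssym x y : hdot (S x) y = hdot (P x) (S y).
    by rewrite -!Vdot -!VS -VP (Gamma_unitary_symmetric SPu).
  have S2 x : nrm (S x) <= 2 * nrm x.
    by rewrite -!Vnrm -VS (Gamma_unitary_nrm_le SPu).
  split; first by move=> x; rewrite !normE Piso.
  have [S' S'b SS'] := adjoint_exists HS.
  have [C [Cb CP CP' C1 CE]] := symbol_exists Piso SP Ssym S2 SS' PP'.
  exists C; split=> //; first exact/(numerical_radius_le1 Cb).
  move=> x; have [C' C'b CC'] := adjoint_exists Cb; rewrite (adj_unique CC').
  by apply: dot_injl => y; rewrite dotDl (adjoint_pairC CC') CE.
have [C' C'b CC'] := adjoint_exists Cb; rewrite (adj_unique CC') in SE.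
have Pnrm x : nrm (P x) = nrm x by apply: complexI; rewrite -!normE Piso.
have C'P : commute_op C' P := commute_adjoint CC' (adjoint_pairC PP') CP'.
have C'P' : commute_op C' P' := commute_adjoint CC' PP' CP.
split; first by move=> x; rewrite !SE linearD CP C'P.
pose A := IsometryPair Pnrm PP'.
have [C1h C1b C1E] := @hull_op_exists R H A C Cb CP'.
have [C1h' C1b' C1E'] := @hull_op_exists R H A C' C'b C'P'.
have S1l : linear (fun x => C1h x + C1h' (hull_shift A x)).
  by move=> a x y; rewrite !linearP scalerDr addrACA.
exists (hull A), (hull_embed A), (linear_pack S1l), (hull_shift A); split.
- exact: hull_separable.
- exact: hull_embed_dot.
- apply: (@Gamma_unitary_intro R (hull A) C1h C1h' (hull_shift A) (hull_unshift A)) => //.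
  + exact: hull_adjoint_pair CC' C1E C1E'.
  + exact: hull_shift_adjoint.
  + exact: hull_unshiftK.
  + exact: hull_shiftK.
  + by move=> x; apply: hull_eq => n; rewrite C1E !hull_shiftE C1E.
  + move=> x; apply: tends_to_bound (hull_dotP _ _) _ => n.
    rewrite C1E; apply: le_trans ((numerical_radius_le1 Cb).1 C1 _) _.
    by rewrite ler_pXn2r ?nnegrE ?nrm_ge0 // hull_nrmE nrm_le_hull_nrm.
- move=> x; rewrite -[LHS]/(C1h (hull_embed A x) + C1h' (hull_shift A (hull_embed A x))).
  rewrite hull_embed_shift; apply: hull_eq => n.
  rewrite hullD C1E C1E' !hull_embedE SE.
  by elim: n => //= n IH; rewrite CP C'P -(linearD P) IH.
- by move=> x; exact: hull_embed_shift.
Qed.
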